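(* There exists an integer $N_0$ such that every integer $n \ge N_0$ can be represented (i) as a sum of two positive integers $n = x + y$ such that $\Omega(x + ny) \le 3$, or (ii) as a sum of two positive integers $n = x + y$ such that $\Omega(x^2 + ny^2) \le 4$.
   Context: For a positive integer $m$, $\Omega(m)$ denotes the number of prime factors of $m$ counted with multiplicity. ''Every sufficiently large integer $n$'' means every integer $n$ at least some fixed bound $N_0$. *)

(* Defs.v *)
From mathcomp Require Import all_boot.
Set Implicit Arguments. Unset Strict Implicit. Unset Printing Implicit Defensive.

(* Omega m = number of prime factors of m counted with multiplicity
   (for m >= 1; Omega 0 = 0 by this formula, but it is only applied to
   positive integers). *)
Definition bigOmega (m : nat) : nat := \sum_(p <- primes m) logn p m.

(* Main.v *)
(* Put q = n - 1. The numbers x + n y with x + y = n are the a = 1 + q k with 2 <= k <= q + 1, and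
   for d coprime to q exactly q/d + O(1) of them are divisible by d. We find among them a number
   with at most three prime factors by a weighted sieve. Write q = exp (132 h), z = exp (16 h),
   y = exp (114 h), and give to each a without prime factors below z the weight

     C - sum_(z <= p < y, p | a) (1 - ln p / ln y),    C = 4 - ln (max a) / ln y  (about 1.684).

   If a has four or more prime factors its weight is at most 0, apart from the few a divisible by
   the square of a prime in [z, y[. So it suffices that the total weight is larger than the
   contribution of those squares. The total is bounded below by a lower sieve for the primes below
   z and, for each p, an upper sieve of level q/p.

   The sieves are combinatorial: the primes below z are cut into the blocks ]exp (t/2), exp t],
   t = 16 h, 8 h, 4 h, ..., and the Bonferroni inequalities are applied inside each block, either
   as in the Brun-Hooley sieve or, for the outer blocks, with alternating upper and lower sieves
   for the smaller primes. Only one fact about the blocks is used, sum_(p in block) 1/p <= 0.7,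
   which follows from Mertens' estimate sum_(p <= x) ln p / p = ln x + O(1). *)
Require Import Defs.
From Stdlib Require Import Reals Lra ZArith.
From HB Require Import structures.
From mathcomp Require Import all_boot zify_ssreflect.
Set Implicit Arguments. Unset Strict Implicit. Unset Printing Implicit Defensive.
(* MathComp binds the key [R] to its own [ring_scope]. *)
Delimit Scope R_scope with R.

(** * Finite sums of reals and Chebyshev's upper bound *)

HB.instance Definition _ := Monoid.isComLaw.Build R 0%R Rplus
  (fun x y z => esym (Rplus_assoc x y z)) Rplus_comm Rplus_0_l.

Notation "\rsum_ ( i <- r ) F" := (\big[Rplus/0%R]_(i <- r) F%R)
  (at level 41, F at level 41, i, r at level 50) : R_scope.
Notation "\rsum_ ( i <- r | P ) F" := (\big[Rplus/0%R]_(i <- r | P) F%R)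
  (at level 41, F at level 41, i, r at level 50) : R_scope.

Local Open Scope R_scope.

Definition ind (b : bool) : R := if b then 1 else 0.

Lemma ind_ge0 b : 0 <= ind b. Proof. case: b => /=; lra. Qed.
Lemma ind_le1 b : ind b <= 1. Proof. case: b => /=; lra. Qed.

Section RealSums.
Variable T : Type.
Implicit Types (s : seq T) (P Q : pred T) (F G : T -> R).

Lemma ler_rsum s P F G :
  (forall i, P i -> F i <= G i) -> \rsum_(i <- s | P i) F i <= \rsum_(i <- s | P i) G i.
Proof. by move=> FG; apply: (big_ind2 Rle) => // *; lra. Qed.

Lemma rsum_ge0 s P F : (forall i, P i -> 0 <= F i) -> 0 <= \rsum_(i <- s | P i) F i.
Proof. by move=> F0; apply: (big_ind (Rle 0)) => // *; lra. Qed.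

Lemma rsum_mulr s P F c : \rsum_(i <- s | P i) (F i * c) = (\rsum_(i <- s | P i) F i) * c.
Proof. by apply: (big_ind2 (fun x y => x = y * c)) => [|*|//]; subst; lra. Qed.

Lemma rsumB s P F G :
  \rsum_(i <- s | P i) (F i - G i) = \rsum_(i <- s | P i) F i - \rsum_(i <- s | P i) G i.
Proof.
elim: s => [|i s IHs]; first by rewrite !big_nil; lra.
by rewrite !big_cons; case: ifP => _; rewrite IHs; lra.
Qed.

Lemma rsum_cst s c : \rsum_(i <- s) c = INR (size s) * c.
Proof.
elim: s => [|i s IHs]; first by rewrite big_nil /=; lra.
by rewrite big_cons IHs (S_INR (size s)); lra.
Qed.

Lemma ler_rsum_sub s P Q F :
  (forall i, P i -> Q i) -> (forall i, Q i -> 0 <= F i) ->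
  \rsum_(i <- s | P i) F i <= \rsum_(i <- s | Q i) F i.
Proof.
move=> PQ F0; rewrite [X in X <= _]big_mkcond [X in _ <= X]big_mkcond.
apply: ler_rsum => i _; case: ifP => [/PQ ->|_]; first lra.
by case: ifP => [/F0|_]; lra.
Qed.

End RealSums.

Lemma rsum_ge_term (T : eqType) (s : seq T) (F : T -> R) j :
  (forall i, 0 <= F i) -> j \in s -> F j <= \rsum_(i <- s) F i.
Proof.
move=> F0; elim: s => // i s IHs; rewrite in_cons big_cons => /orP[/eqP <-|/IHs le_s].
  by have : 0 <= \rsum_(i <- s) F i; [exact: rsum_ge0|lra].
by have := F0 i; lra.
Qed.

(** * Casts to the reals and logarithms of natural numbers *)

Lemma INRD m n : INR (m + n) = INR m + INR n. Proof. exact: plus_INR. Qed.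
Lemma INRM m n : INR (m * n) = INR m * INR n. Proof. exact: mult_INR. Qed.
Lemma INRX m n : INR (m ^ n) = INR m ^ n.
Proof. by elim: n => [|n IHn] //; rewrite expnS INRM IHn. Qed.
Lemma ler_INR m n : (m <= n)%N -> INR m <= INR n. Proof. by move/leP/le_INR. Qed.
Lemma ltr_INR m n : (m < n)%N -> INR m < INR n. Proof. by move/ltP/lt_INR. Qed.
Lemma INR_gt0 n : (0 < n)%N -> 0 < INR n. Proof. exact: ltr_INR. Qed.
Lemma INR_ge1 n : (0 < n)%N -> 1 <= INR n. Proof. exact: ler_INR. Qed.
Lemma INR_ge2 n : (1 < n)%N -> 2 <= INR n. Proof. exact: ler_INR. Qed.

Definition lnn n := ln (INR n).

Lemma lnn_ge0 n : 0 <= lnn n.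
Proof.
(* [ln] takes the value 0 outside the positive reals, which settles n = 0. *)
rewrite /lnn; case: n => [|n]; first by rewrite /= /ln; case: Rlt_dec => [h|_]; [exfalso; lra|lra].
rewrite -ln_1; have := @INR_ge1 n.+1 isT; case/Rle_lt_or_eq_dec => [lt1|<-]; last lra.
by apply/Rlt_le/ln_increasing; lra.
Qed.

Lemma ler_ln x y : 0 < x -> x <= y -> ln x <= ln y.
Proof. by move=> x0 [/(ln_increasing _ _ x0)|->]; lra. Qed.

Lemma ler_lnn m n : (0 < m)%N -> (m <= n)%N -> lnn m <= lnn n.
Proof. by move=> m0 mn; apply: ler_ln (INR_gt0 m0) (ler_INR mn). Qed.

Lemma lnnM m n : (0 < m)%N -> (0 < n)%N -> lnn (m * n) = lnn m + lnn n.
Proof. by move=> m0 n0; rewrite /lnn INRM ln_mult //; exact: INR_gt0. Qed.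

Lemma ln_le_sub1 x : 0 < x -> ln x <= x - 1.
Proof. by move=> x0; have := exp_ineq1_le (ln x); rewrite exp_ln //; lra. Qed.

(** Logarithm of the prime factorisation. The range may extend to any m >= n, so that these
    identities can be added over one common range; an index that is not prime has exponent 0. *)
Lemma lnn_logn n m : (0 < n <= m)%N ->
  lnn n = \rsum_(p <- index_iota 0 m.+1) INR (logn p n) * lnn p.
Proof.
case/andP=> n0 nm; rewrite -{1}(partnT n0) (widen_partn _ nm).
suff : forall s, (0 < \prod_(p <- s) p ^ logn p n)%N /\
   lnn (\prod_(p <- s) p ^ logn p n) = \rsum_(p <- s) INR (logn p n) * lnn p.
  by case/(_ (index_iota 0 m.+1)).
have pw (p : nat) : (0 < p ^ logn p n)%N /\ lnn (p ^ logn p n) = INR (logn p n) * lnn p.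
  have [pr|npr] := boolP (prime p); last by rewrite lognE (negPf npr) /lnn /= ln_1; split => //; lra.
  by split; rewrite ?expn_gt0 ?prime_gt0 // /lnn INRX ln_pow //; apply/INR_gt0/prime_gt0.
elim=> [|p s [gt0 IHs]]; first by rewrite !big_nil /lnn ln_1.
by rewrite !big_cons; case: (pw p) => gp Ep; rewrite muln_gt0 gp gt0 lnnM // IHs Ep.
Qed.

(** * Logarithms of factorials and Legendre's formula *)

Lemma lnn_fact n m : (n <= m)%N ->
  lnn n`! = \rsum_(p <- index_iota 0 m.+1) INR (logn p n`!) * lnn p.
Proof.
elim: n => [_|n IHn nm].
  by rewrite fact0 /lnn ln_1 big1 // => p _; rewrite logn1 /=; lra.
rewrite factS lnnM ?fact_gt0 // (@lnn_logn n.+1 m) // IHn; last exact: ltnW.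
rewrite -big_split; apply: eq_bigr => p _ /=.
by rewrite lognM ?fact_gt0 // INRD; lra.
Qed.

Lemma lnn_fact_le n : lnn n`! <= INR n * lnn n.
Proof.
elim: n => [|n IHn]; first by rewrite /lnn /= ln_1; lra.
rewrite factS lnnM ?fact_gt0 // S_INR.
suff : INR n * lnn n <= INR n * lnn n.+1 by lra.
case: n {IHn} => [|n]; first by rewrite /=; lra.
by apply: Rmult_le_compat_l; [exact: pos_INR|exact: ler_lnn].
Qed.

Lemma lnn_fact_ge n : INR n * lnn n - INR n <= lnn n`!.
Proof.
elim: n => [|n IHn]; first by rewrite /lnn /= ln_1; lra.
rewrite factS lnnM ?fact_gt0 // S_INR.
case: n IHn => [|n] IHn; first by rewrite fact0 /lnn /= ln_1; lra.
have n0 : 0 < INR n.+1 by exact: INR_gt0.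
have : lnn n.+2 - lnn n.+1 <= / INR n.+1.
  have E : INR n.+2 = INR n.+1 * (1 + / INR n.+1) by rewrite (S_INR n.+1); field; lra.
  have i0 := Rinv_0_lt_compat _ n0.
  rewrite /lnn E ln_mult; [|lra|lra].
  by have := @ln_le_sub1 (1 + / INR n.+1); lra.
move/(Rmult_le_compat_l (INR n.+1)); rewrite Rinv_r; last lra.
by move=> /(_ (Rlt_le _ _ n0)); lra.
Qed.

Lemma divn_INR_le m d : (0 < d)%N -> INR (m %/ d) <= INR m / INR d.
Proof.
move=> d0; have := INR_gt0 d0 => d0'; apply: (Rmult_le_reg_r (INR d)) => //.
by rewrite -INRM; have := ler_INR (leq_trunc_div m d); rewrite /Rdiv Rmult_assoc Rinv_l; lra.
Qed.

Lemma divn_INR_ge m d : (0 < d)%N -> INR m / INR d - 1 <= INR (m %/ d).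
Proof.
move=> d0; have := INR_gt0 d0 => d0'; apply: (Rmult_le_reg_r (INR d)) => //.
have : INR m <= INR (m %/ d) * INR d + INR d.
  by rewrite -INRM -INRD; apply: ler_INR; rewrite {1}(divn_eq m d) leq_add2l ltnW // ltn_mod.
rewrite Rmult_minus_distr_r /Rdiv Rmult_assoc Rinv_l; lra.
Qed.

(** Legendre's formula with the floors dropped: the geometric series of the 1 / p^(k+1) has partial
    sums (1 - 1 / p^K) / (p - 1), the form proved by induction on K. *)
Lemma logn_fact_le p n : prime p -> INR (logn p n`!) <= INR n / (INR p - 1).
Proof.
move=> pr; rewrite logn_fact //; have p2 := INR_ge2 (prime_gt1 pr).
have -> : (\sum_(1 <= k < n.+1) n %/ p ^ k = \sum_(0 <= k < n) n %/ p ^ k.+1)%N.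
  by rewrite big_add1.
have n0 := pos_INR n.
suff H K : INR (\sum_(0 <= k < K) n %/ p ^ k.+1) <= INR n / (INR p - 1) * (1 - / INR p ^ K).
  apply: Rle_trans (H n) _; rewrite -[X in _ <= X]Rmult_1_r; apply: Rmult_le_compat_l.
    by apply: Rmult_le_pos => //; apply/Rlt_le/Rinv_0_lt_compat; lra.
  by have := Rinv_0_lt_compat _ (pow_lt (INR p) n ltac:(lra)); lra.
elim: K => [|K IHK]; first by rewrite big_nil /= Rinv_1; lra.
rewrite big_nat_recr //= INRD; have := @divn_INR_le n (p ^ K.+1).
rewrite expn_gt0 prime_gt0 // => /(_ isT); rewrite INRX => H.
apply: Rle_trans (Rplus_le_compat _ _ _ _ IHK H) _; apply: Req_le => /=.
have := pow_lt (INR p) K ltac:(lra); move: (INR p ^ K) => x x0; field; lra.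
Qed.

Lemma logn_fact_ge p n : prime p -> INR n / INR p - 1 <= INR (logn p n`!).
Proof.
move=> pr; case: n => [|n].
  by rewrite /= /Rdiv Rmult_0_l; have := pos_INR (logn p 0`!); lra.
apply: Rle_trans (divn_INR_ge n.+1 (prime_gt0 pr)) _.
by apply: ler_INR; rewrite logn_fact // big_nat_recl // expn1 leq_addr.
Qed.

Lemma sum_nonprime_logn m n :
  \rsum_(p <- index_iota 0 m) INR (logn p n) * lnn p =
  \rsum_(p <- index_iota 0 m | prime p) INR (logn p n) * lnn p.
Proof.
rewrite [RHS]big_mkcond; apply: eq_bigr => p _; case: ifP => // npr.
by rewrite lognE npr /=; lra.
Qed.

(** * Chebyshev's bound for the sum of ln p *)

Lemma bin_le_exp2 n m : ('C(n, m) <= 2 ^ n)%N.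
Proof.
elim: n m => [|n IHn] [|m]; rewrite ?bin0 ?bin0n ?expn_gt0 // binS expnS mul2n -addnn.
exact: leq_add.
Qed.

(** Every prime above n / 2 (rounded up) and up to n divides the central binomial coefficient, which
    is at most 2 ^ n. *)
Lemma theta_half n :
  \rsum_(p <- index_iota 0 n.+1 | prime p) lnn p <=
  \rsum_(p <- index_iota 0 (uphalf n).+1 | prime p) lnn p + INR n * ln 2.
Proof.
have le_un : (uphalf n <= n)%N by rewrite leq_uphalf_double -addnn leq_addr.
rewrite (@big_cat_nat _ _ _ (uphalf n).+1) //=.
apply: Rplus_le_compat_l.
set C := 'C(n, n./2); have hn : (n./2 <= n)%N by rewrite -{2}(odd_double_half n) -addnn; lia.
have C0 : (0 < C)%N by rewrite bin_gt0.
have -> : INR n * ln 2 = lnn (2 ^ n) by rewrite /lnn INRX ln_pow //=; lra.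
apply: Rle_trans (ler_lnn C0 (bin_le_exp2 _ _)).
rewrite (@lnn_logn C (C + n)); last by rewrite C0 leq_addr.
rewrite sum_nonprime_logn.
have H0 s : 0 <= \rsum_(p <- s | prime p) INR (logn p C) * lnn p.
  by apply: rsum_ge0 => p _; apply: Rmult_le_pos (pos_INR _) (lnn_ge0 _).
rewrite [X in _ <= X](@big_cat_nat _ _ _ n.+1) //=; last by rewrite ltnS leq_addl.
rewrite [X in _ <= X + _](@big_cat_nat _ _ _ (uphalf n).+1) //=.
have := H0 (index_iota 0 (uphalf n).+1); have := H0 (index_iota n.+1 (C + n).+1).
suff : \rsum_(p <- index_iota (uphalf n).+1 n.+1 | prime p) lnn p <=
       \rsum_(p <- index_iota (uphalf n).+1 n.+1 | prime p) INR (logn p C) * lnn p by lra.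
rewrite big_seq_cond [X in _ <= X]big_seq_cond; apply: ler_rsum => p /andP[].
rewrite mem_index_iota ltnS => /andP[up pn] pr.
suff : (0 < logn p C)%N by move/INR_ge1; have := lnn_ge0 p; nra.
rewrite logn_gt0 mem_primes pr C0 /=.
(* p divides n! = C (n./2)! (n - n./2)! but exceeds both factorial arguments, so it divides C. *)
have : p %| n`! by rewrite dvdn_fact // prime_gt0.
rewrite -(bin_fact hn) !Euclid_dvdM //.
have nd k : (k <= uphalf n)%N -> ~~ (p %| k`!).
  move=> ku; apply/negP; rewrite fact_prod Euclid_dvd_prod // big_has => /hasP[i].
  rewrite mem_index_iota => /andP[i0 ik] /(dvdn_leq i0) => pi.
  by have := leq_trans up pi; rewrite leqNgt ltnS (leq_trans _ ku).
rewrite (negPf (nd _ _)); last by rewrite uphalf_half leq_addl.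
rewrite (negPf (nd _ _)) ?orbF //.
by rewrite leq_subLR -{1}(odd_double_half n) uphalf_half -addnn addnCA.
Qed.

Lemma ln2_lt1 : ln 2 < 1.
Proof. by have := exp_ineq1 1 ltac:(lra); move/(ln_increasing 2 _ ltac:(lra)); rewrite ln_exp; lra. Qed.

(** Strong induction by halving: 2 (n + 1) + n ln 2 <= 4 n as soon as n >= 2. *)
Lemma theta_le n : \rsum_(p <- index_iota 0 n.+1 | prime p) lnn p <= 4 * INR n.
Proof.
have [m] := ubnP n; elim: m n => // m IHm n; rewrite ltnS => nm.
have [n2|] := leqP 2 n; last first.
  rewrite ltnS => n1; rewrite big1_seq; first by have := pos_INR n; lra.
  by move=> p /andP[/prime_gt1 p1]; rewrite mem_index_iota => pn; lia.
apply: Rle_trans (theta_half n) _.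
have un : (uphalf n < n)%N by rewrite -{2}(odd_double_half n) uphalf_half -addnn; move: n2; case: (odd n); lia.
have := IHm _ (leq_trans un nm).
have : 2 * INR (uphalf n) <= INR n + 1.
  rewrite -[2]/(INR 2) -INRM -[1]/(INR 1) -INRD; apply: ler_INR.
  by rewrite -{2}(odd_double_half n) uphalf_half -addnn; lia.
by have := ln2_lt1; have := INR_ge2 n2; nra.
Qed.

(** * Mertens' estimate *)

(** (ln k + 2) / k serves as a discrete antiderivative, because ln k - ln (k - 1) <= 1 / (k - 1).
    The sum of ln p / (p (p - 1)) then telescopes to at most 2. *)
Lemma telescoping_ln k : (1 < k)%N ->
  lnn k / (INR k * (INR k - 1)) <= (lnn k.-1 + 2) / (INR k - 1) - (lnn k + 2) / INR k.
Proof.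
case: k => [|[|k]] //= _; have k0 : 0 < INR k.+1 by exact: INR_gt0.
have E : INR k.+2 = INR k.+1 * (1 + / INR k.+1) by rewrite (S_INR k.+1); field; lra.
have i0 := Rinv_0_lt_compat _ k0.
have : lnn k.+2 - / INR k.+1 <= lnn k.+1.
  rewrite /lnn E ln_mult; [|lra|lra]; have := @ln_le_sub1 (1 + / INR k.+1); lra.
have k1 : 1 <= INR k.+1 by exact: INR_ge1.
rewrite -/(INR k.+2) [in X in _ -> X](S_INR k.+1).
move: (lnn k.+2) (lnn k.+1) (INR k.+1) k0 k1 {E} i0 => a b x x0 x1 i0 H.
have -> : x + 1 - 1 = x by lra.
suff : 0 <= (b + 2) / x - (a + 2) / (x + 1) - a / ((x + 1) * x) by lra.
have -> : (b + 2) / x - (a + 2) / (x + 1) - a / ((x + 1) * x) =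
  ((b - a + / x) * (x + 1) + (1 - / x)) / ((x + 1) * x) by field; lra.
apply: Rmult_le_pos; last by apply/Rlt_le/Rinv_0_lt_compat; nra.
have : / x <= 1 by rewrite -Rinv_1; apply: Rinv_le_contravar; lra.
by move=> ?; nra.
Qed.

Lemma sum_ln_tail n : (0 < n)%N ->
  \rsum_(p <- index_iota 0 n.+1 | prime p) lnn p / (INR p * (INR p - 1)) <=
  2 - (lnn n + 2) / INR n.
Proof.
elim: n => // n IHn _; case: n IHn => [_|n /(_ isT) IHn].
  by rewrite /index_iota !big_cons big_nil /= /lnn /= ln_1; lra.
rewrite big_mkcond big_nat_recr //= -big_mkcond /=.
have k1 : 1 <= INR n.+1 by exact: INR_ge1.
have := @telescoping_ln n.+2 isT; rewrite /= -/(INR n.+2) -/(INR n.+1).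
have -> : INR n.+2 - 1 = INR n.+1 by rewrite (S_INR n.+1); lra.
move=> H; have : 0 <= lnn n.+2 / (INR n.+2 * INR n.+1).
  apply: Rmult_le_pos; first exact: lnn_ge0.
  by apply/Rlt_le/Rinv_0_lt_compat/Rmult_lt_0_compat; apply: INR_gt0.
by case: ifP => _; move: H IHn; rewrite /= -/(INR n.+2); lra.
Qed.

Definition mertens_sum n := \rsum_(p <- index_iota 0 n.+1 | prime p) lnn p / INR p.

(** ln n! is at most n ln n and at least the sum of (n / p - 1) ln p; the subtracted sum of ln p, at
    most 4 n, gives the constant 4. *)
Lemma mertens_le n : (0 < n)%N -> mertens_sum n <= lnn n + 4.
Proof.
move=> n0; have n0' := INR_gt0 n0.
have : INR n * mertens_sum n - \rsum_(p <- index_iota 0 n.+1 | prime p) lnn p <= lnn n`!.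
  rewrite (lnn_fact (leqnn n)) sum_nonprime_logn /mertens_sum Rmult_comm -rsum_mulr -rsumB.
  apply: ler_rsum => p pr; have := logn_fact_ge n pr; have := lnn_ge0 p.
  move=> l0 /(Rmult_le_compat_r _ _ _ l0); rewrite /Rdiv; lra.
have := lnn_fact_le n; have := theta_le n => H1 H2 H3.
by apply: (Rmult_le_reg_l (INR n)) => //; lra.
Qed.

(** The exponent of p in n! is at most n / p + n / (p (p - 1)). The constant 3 is 1 from ln n! >= n
    ln n - n plus 2 from [sum_ln_tail]. *)
Lemma mertens_ge n : (0 < n)%N -> lnn n - 3 <= mertens_sum n.
Proof.
move=> n0; have n0' := INR_gt0 n0.
have H1 : lnn n`! <= INR n * (mertens_sum n +
    \rsum_(p <- index_iota 0 n.+1 | prime p) lnn p / (INR p * (INR p - 1))).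
  rewrite (lnn_fact (leqnn n)) sum_nonprime_logn /mertens_sum -big_split Rmult_comm -rsum_mulr.
  apply: ler_rsum => p pr; have := logn_fact_le n pr; have := lnn_ge0 p.
  have p2 := INR_ge2 (prime_gt1 pr).
  move=> l0 /(Rmult_le_compat_r _ _ _ l0) H; apply: Rle_trans H _; apply: Req_le.
  by rewrite /=; field; lra.
have := lnn_fact_ge n; have := sum_ln_tail n0 => H2 H3.
have g0 : 0 <= (lnn n + 2) / INR n.
  by apply: Rmult_le_pos; [have := lnn_ge0 n; lra|apply/Rlt_le/Rinv_0_lt_compat].
by apply: (Rmult_le_reg_l (INR n)) => //; nra.
Qed.

(* [p < cl x] iff [p <= exp x], so that the primes below [cl x] are those with [ln p <= x]. *)
Definition cl (x : R) : nat := Z.to_nat (up (exp x)).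

Lemma cl_spec x : exp x < INR (cl x) <= exp x + 1.
Proof.
have [u1 u2] := archimed (exp x); have e0 := exp_pos x.
have u0 : (0 <= up (exp x))%Z by apply: le_IZR; lra.
by rewrite INR_IZR_INZ /cl Z2Nat.id //; lra.
Qed.

Lemma ltn_cl p x : (p < cl x)%N <-> INR p <= exp x.
Proof.
have [c1 c2] := cl_spec x; split => [/ler_INR|].
  by rewrite S_INR; lra.
by move=> px; apply/ltP/INR_lt; lra.
Qed.

Lemma prime_lt_cl p x : prime p -> ((p < cl x)%N <-> lnn p <= x).
Proof.
move=> pr; have p0 := INR_gt0 (prime_gt0 pr); rewrite ltn_cl; split => H.
  by rewrite -(ln_exp x); apply: ler_ln.
by rewrite -(exp_ln (INR p)) //; rewrite -/(lnn p); case: H => [/exp_increasing|->]; lra.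
Qed.

Lemma cl_le x y : x <= y -> (cl x <= cl y)%N.
Proof.
move=> xy; case E: (cl x) => [|k] //; apply/ltn_cl.
have /ltn_cl : (k < cl x)%N by rewrite E.
by case: xy => [/exp_increasing|->]; lra.
Qed.

Lemma cl_ge2 x : 0 <= x -> (1 < cl x)%N.
Proof. by move=> x0; apply/ltn_cl; rewrite /=; have := exp_ineq1_le x; lra. Qed.

Lemma lnn_pred_cl_le x : 0 <= x -> lnn (cl x).-1 <= x.
Proof.
move=> /cl_ge2; have [c1 c2] := cl_spec x; case: (cl x) c1 c2 => [|[|k]] //= c1 c2 _.
rewrite -[X in _ <= X](ln_exp x); apply: ler_ln; first exact: INR_gt0.
by move: c2; rewrite -/(INR k.+2) (S_INR k.+1); lra.
Qed.

(** [(cl x).-1] is the integer part of exp x, hence more than half of exp x, and ln 2 < 1. *)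
Lemma lnn_pred_cl_ge x : 0 <= x -> x - 1 <= lnn (cl x).-1.
Proof.
move=> /cl_ge2; have [c1 c2] := cl_spec x; case: (cl x) c1 c2 => [|[|k]] //= c1 c2 _.
have k1 : 1 <= INR k.+1 by exact: INR_ge1.
have : x <= ln (INR k.+1 * 2).
  rewrite -(ln_exp x); apply: ler_ln; first exact: exp_pos.
  by move: c1; rewrite -/(INR k.+2) (S_INR k.+1); lra.
by rewrite ln_mult; [rewrite -/(lnn k.+1); have := ln2_lt1; lra|lra|lra].
Qed.

(** * Sums over the primes of a block *)

Lemma mertens_block u v : 0 <= u -> u <= v ->
  \rsum_(p <- index_iota (cl u) (cl v) | prime p) lnn p / INR p <= v - u + 8.
Proof.
move=> u0 uv; have v0 : 0 <= v by lra.
have := cl_ge2 u0; have := cl_ge2 v0 => cv cu.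
have : mertens_sum (cl v).-1 = mertens_sum (cl u).-1 +
    \rsum_(p <- index_iota (cl u) (cl v) | prime p) lnn p / INR p.
  rewrite /mertens_sum !prednK ?(ltnW cu) ?(ltnW cv) // (@big_cat_nat _ _ _ (cl u)) //.
  exact: cl_le.
have cv0 : (0 < (cl v).-1)%N by rewrite -ltnS prednK // ltnW.
have cu0 : (0 < (cl u).-1)%N by rewrite -ltnS prednK // ltnW.
have := mertens_le cv0; have := mertens_ge cu0.
have := lnn_pred_cl_le v0; have := lnn_pred_cl_ge u0; lra.
Qed.

(** An integer upper bound for 10^6 / n, so that sums of reciprocals can be certified by integer
    computation. *)
Definition zinv (n : nat) : Z := (1000000 / Z.of_nat n + 1)%Z.

Lemma zinv_ge n : (0 < n)%N -> / INR n <= IZR (zinv n) / 1000000.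
Proof.
move=> n0; have := INR_gt0 n0; rewrite INR_IZR_INZ => n0'.
have nz : (0 < Z.of_nat n)%Z by apply: lt_IZR.
have := Z.mod_pos_bound 1000000 _ nz; have := Z.div_mod 1000000 (Z.of_nat n) ltac:(lia).
rewrite /zinv plus_IZR; set d := (_ / _)%Z; set r := (_ mod _)%Z => E [_ /IZR_lt r1].
have := f_equal IZR E; rewrite plus_IZR mult_IZR => E'.
apply: (Rmult_le_reg_r (IZR (Z.of_nat n))) => //; rewrite Rinv_l; lra.
Qed.

(** Left Riemann sum in 64 steps for the integral of 1 / x over [1, 2], slightly above ln 2. *)
Lemma harmonic64 : \rsum_(i <- index_iota 0 64) / INR (64 + i) <= 0.6975.
Proof.
have : forall s, \rsum_(i <- s) / INR (64 + i) <=
    IZR (foldr (fun i z => zinv (64 + i) + z)%Z 0%Z s) / 1000000.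
  elim=> [|i s IHs]; first by rewrite big_nil -[foldr _ _ _]/0%Z; lra.
  rewrite big_cons -[foldr _ _ (i :: s)]/(zinv (64 + i) + foldr _ _ s)%Z plus_IZR.
  by have := @zinv_ge (64 + i)%N isT; lra.
move/(_ (index_iota 0 64)) => H; apply: Rle_trans H _.
have /IZR_le : (foldr (fun i z => zinv (64 + i) + z) 0 (index_iota 0 64) <= 697500)%Z.
  by apply/Z.leb_le; vm_compute.
lra.
Qed.

(** Here ln p >= u, so 1 / p <= (ln p / p) / u, and p - 1 >= ln p >= u bounds the passage from 1 / p
    to 1 / (p - 1) by the factor 1 + 1 / u. *)
Lemma sum_inv_subblock u v : 1 <= u -> u <= v ->
  \rsum_(p <- index_iota (cl u) (cl v) | prime p) / (INR p - 1) <= (v - u + 8) / u * (1 + / u).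
Proof.
move=> u1 uv; have u0 : 0 <= u by lra.
have iu : 0 < / u by apply: Rinv_0_lt_compat; lra.
have := mertens_block u0 uv.
move/(Rmult_le_compat_r (/ u * (1 + / u))) => /(_ ltac:(nra)).
rewrite -rsum_mulr => H; apply: Rle_trans (_ : _ <= (v - u + 8) * (/ u * (1 + / u))) _; last first.
  by rewrite /Rdiv; lra.
apply: Rle_trans H.
rewrite big_seq_cond [X in _ <= X]big_seq_cond; apply: ler_rsum => p /andP[].
rewrite mem_index_iota => /andP[up _] pr.
have p2 := INR_ge2 (prime_gt1 pr).
have lp : u <= lnn p.
  by apply: Rnot_lt_le => /Rlt_le/(prime_lt_cl _ pr); rewrite ltnNge up.
have ip : 0 < / (INR p - 1) by apply: Rinv_0_lt_compat; lra.
have E : / (INR p - 1) = / INR p * (1 + / (INR p - 1)) by field; lra.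
have : / (INR p - 1) <= / u.
  by apply: Rinv_le_contravar; [lra|have := @ln_le_sub1 (INR p); rewrite -/(lnn p); lra].
have : 1 <= lnn p * / u.
  by rewrite -(Rinv_r u); [apply: Rmult_le_compat_r|]; lra.
have : 0 < / INR p by apply: Rinv_0_lt_compat; lra.
rewrite /Rdiv; move: E ip iu; move: (/ INR p) (/ (INR p - 1)) (/ u) (lnn p) => a b c d E b0 c0 a0 dc bc.
have -> : d * a * (c * (1 + c)) = (d * c) * (a * (1 + c)) by lra.
have H : b <= a * (1 + c) by rewrite E; apply: Rmult_le_compat_l; lra.
by apply: Rle_trans H _; rewrite -[X in X <= _]Rmult_1_l; apply: Rmult_le_compat_r => //; nra.
Qed.

(** Bounding ln p below by t / 2 on the whole block would only give about 1. Cutting [t / 2, t] into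
    64 equal pieces gives the sum of [harmonic64], and the ratio 0.7 / 0.6975 absorbs the factors 1
    + 1024 / t and 1 + 1 / w. *)
Lemma sum_inv_block t : 2000000 <= t ->
  \rsum_(p <- index_iota (cl (t / 2)) (cl t) | prime p) / (INR p - 1) <= 0.7.
Proof.
move=> t0; pose w i := t / 2 * (1 + INR i / 64).
have ww i : w i.+1 = w i + t / 128 by rewrite /w S_INR; lra.
have w0 i : 1000000 <= w i by rewrite /w; have := pos_INR i; nra.
have w0E : w 0%N = t / 2 by rewrite /w /=; lra.
have -> : t = w 64%N by rewrite /w /=; lra.
have -> : w 64%N / 2 = w 0%N by rewrite /w /=; lra.
apply: Rle_trans (_ : _ <= (\rsum_(i <- index_iota 0 64) / INR (64 + i)) * (0.7 / 0.6975)) _; last first.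
  by have := harmonic64; lra.
rewrite -rsum_mulr.
suff H n : \rsum_(p <- index_iota (cl (w 0%N)) (cl (w n)) | prime p) / (INR p - 1) <=
    \rsum_(i <- index_iota 0 n) (/ INR (64 + i) * (0.7 / 0.6975)) by exact: H.
elim: n => [|n IHn]; first by rewrite !big_geq //; lra.
rewrite (@big_cat_nat _ _ _ (cl (w n))); first last.
- by apply: cl_le; rewrite ww; lra.
- by elim: n {IHn} => // n IHn; apply: leq_trans IHn _; apply: cl_le; rewrite ww; lra.
rewrite big_nat_recr //; apply: Rplus_le_compat IHn _.
apply: Rle_trans (sum_inv_subblock _ _) _; [by have := w0 n; lra|by rewrite ww; lra|].
have n0 : 0 < INR (64 + n) by apply: INR_gt0.
have Ew : w n = t / 128 * INR (64 + n) by rewrite INRD /w (_ : INR 64 = 64) ?INR_IZR_INZ //; lra.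
have -> : (w n.+1 - w n + 8) / w n = / INR (64 + n) * (1 + 1024 / t).
  by rewrite ww Ew; field; lra.
rewrite Rmult_assoc; apply: Rmult_le_compat_l; first by apply/Rlt_le/Rinv_0_lt_compat.
have : / w n <= / 1000000 by apply: Rinv_le_contravar => //; lra.
have : / t <= / 2000000 by apply: Rinv_le_contravar => //; lra.
have : 0 < / w n by apply: Rinv_0_lt_compat; have := w0 n; lra.
have : 0 < / t by apply: Rinv_0_lt_compat; lra.
rewrite /Rdiv; move: (/ t) (/ w n) => a b; nra.
Qed.

(** A lower bound for exp (- 0.7 / 128), squared seven times, bounds exp (- 0.7) below. *)
Lemma exp_07 : exp 0.7 <= 2.02.
Proof.
have H1 : 1 - 0.7 / 128 <= exp (- 0.7 / 128) by have := exp_ineq1_le (- 0.7 / 128); lra.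
have sq x a b : a <= exp x -> 0 <= a -> b <= a * a -> b <= exp (x + x).
  by move=> ax a0 ab; rewrite exp_plus; nra.
have H2 := @sq _ _ 0.98909 H1 ltac:(lra) ltac:(lra).
have H3 := @sq _ _ 0.97829 H2 ltac:(lra) ltac:(lra).
have H4 := @sq _ _ 0.95705 H3 ltac:(lra) ltac:(lra).
have H5 := @sq _ _ 0.91594 H4 ltac:(lra) ltac:(lra).
have H6 := @sq _ _ 0.83894 H5 ltac:(lra) ltac:(lra).
have H7 := @sq _ _ 0.70382 H6 ltac:(lra) ltac:(lra).
have H8 := @sq _ _ 0.49536 H7 ltac:(lra) ltac:(lra).
have e0 := exp_pos 0.7.
have : exp 0.7 * 0.49536 <= 1.
  apply: Rle_trans (Rmult_le_compat_l _ _ _ (Rlt_le _ _ e0) H8) _.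
  rewrite -exp_plus (_ : 0.7 + _ = 0); last by lra.
  by rewrite exp_0; lra.
lra.
Qed.

(** * Elementary symmetric sums and the Bonferroni inequalities *)

Fixpoint elsym (xs : seq R) (k : nat) : R :=
  match k, xs with
  | 0%N, _ => 1
  | _.+1, [::] => 0
  | k'.+1, x :: xs' => elsym xs' k + x * elsym xs' k'
  end.

(** On indicators of p | a this is the indicator that no p divides a; on the numbers 1 / p it is an
    Euler product. *)
Definition prodC (xs : seq R) : R := foldr (fun x r => (1 - x) * r) 1 xs.

(** Inclusion-exclusion truncated after the subsets of size b. *)
Fixpoint bonf (xs : seq R) (b : nat) : R :=
  match b with
  | 0%N => 1
  | b'.+1 => bonf xs b' + (-1) ^ b * elsym xs b
  end.

Definition in01 (xs : seq R) := forall x, List.In x xs -> 0 <= x <= 1.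

Lemma in01_cons x xs : in01 (x :: xs) -> 0 <= x <= 1 /\ in01 xs.
Proof. by move=> H; split=> [|y Hy]; apply: H; [left|right]. Qed.

Lemma in01_map (T : eqType) (g : T -> R) s :
  (forall i, i \in s -> 0 <= g i <= 1) -> in01 (map g s).
Proof.
elim: s => [_ x []|i s IHs H x /= [<-|]]; first by apply: H; rewrite mem_head.
by apply: IHs => j js; apply: H; rewrite in_cons js orbT.
Qed.

Lemma elsym0 xs : elsym xs 0 = 1. Proof. by case: xs. Qed.

Lemma elsym_ge0 xs k : in01 xs -> 0 <= elsym xs k.
Proof.
elim: xs k => [|x xs IHxs] [|k] /=; try lra.
by move=> /in01_cons[x01 /[dup] /(IHxs k) H1 /(IHxs k.+1) H2]; nra.
Qed.

Lemma prodC01 xs : in01 xs -> 0 <= prodC xs <= 1.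
Proof. by elim: xs => [|x xs IHxs] /=; [lra|move=> /in01_cons[x01 /IHxs]; nra]. Qed.

Lemma prodC_cat xs ys : prodC (xs ++ ys) = prodC xs * prodC ys.
Proof. by elim: xs => [|x xs IHxs] /=; [lra|rewrite IHxs; lra]. Qed.

Lemma bonf_cons x xs b : bonf (x :: xs) b.+1 = bonf xs b.+1 - x * bonf xs b.
Proof.
elim: b => [|b IHb]; first by rewrite /= elsym0; lra.
by rewrite -[LHS]/(bonf (x :: xs) b.+1 + (-1) ^ b.+2 * elsym (x :: xs) b.+2) IHb /=; lra.
Qed.

(** By [bonf_cons], the signed error of [x :: xs] at order b + 1 is that of [xs] at order b + 1 plus
    x times that of [xs] at order b; the bounding terms obey the same recurrence. *)
Lemma bonferroni xs b : in01 xs ->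
  0 <= (-1) ^ b * (bonf xs b - prodC xs) <= elsym xs b.+1.
Proof.
elim: xs b => [b _|x xs IHxs [|b]].
- suff -> : bonf [::] b = 1 by rewrite /=; lra.
  by elim: b => //= b ->; lra.
- by move=> /in01_cons[x01 xs01]; have := IHxs 0%N xs01; have := prodC01 xs01; rewrite /= elsym0; nra.
move=> /in01_cons[x01 xs01]; have := IHxs b.+1 xs01; have := IHxs b xs01.
rewrite bonf_cons.
have -> : prodC (x :: xs) = (1 - x) * prodC xs by [].
have -> : elsym (x :: xs) b.+2 = elsym xs b.+2 + x * elsym xs b.+1 by [].
have -> : (-1) ^ b.+1 = - (-1) ^ b by rewrite /=; lra.
move: (bonf xs b) (bonf xs b.+1) (prodC xs) (elsym xs b.+1) (elsym xs b.+2) => B B' P e e' H H'.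
have -> : - (-1) ^ b * (B' - x * B - (1 - x) * P) =
  - (-1) ^ b * (B' - P) + x * ((-1) ^ b * (B - P)) by lra.
nra.
Qed.

(** Keeps the first two terms of the binomial expansion; this is the induction step of e_k <= s^k /
    k!. *)
Lemma pow_fact_step (s x : R) k : 0 <= s -> 0 <= x ->
  s ^ k.+1 / INR k.+1`! + x * (s ^ k / INR k`!) <= (s + x) ^ k.+1 / INR k.+1`!.
Proof.
move=> s0 x0; have kf := INR_gt0 (fact_gt0 k); have k1 : 0 < INR k.+1 by exact: INR_gt0.
have H : s ^ k.+1 + INR k.+1 * x * s ^ k <= (s + x) ^ k.+1.
  elim: k {kf k1} => [|k IHk]; first by rewrite /=; lra.
  have := pow_le s k s0; rewrite (S_INR k.+1) -[(s + x) ^ k.+2]/((s + x) * (s + x) ^ k.+1).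
  have := pos_INR k.+1; move: IHk; rewrite -[s ^ k.+2]/(s * (s * s ^ k)) -[s ^ k.+1]/(s * s ^ k).
  move: (s ^ k) ((s + x) ^ k.+1) (INR k.+1) => a c n IH n0 a0.
  have : (s + x) * (s * a + n * x * a) <= (s + x) * c by apply: Rmult_le_compat_l; lra.
  have : 0 <= x * (n * x * a) by repeat apply: Rmult_le_pos.
  lra.
rewrite factS INRM.
have -> : s ^ k.+1 / (INR k.+1 * INR k`!) + x * (s ^ k / INR k`!) =
   (s ^ k.+1 + INR k.+1 * x * s ^ k) / (INR k.+1 * INR k`!) by field; lra.
by apply: Rmult_le_compat_r H; apply/Rlt_le/Rinv_0_lt_compat/Rmult_lt_0_compat.
Qed.

Lemma elsym_le xs k s : in01 xs -> foldr Rplus 0 xs <= s -> elsym xs k <= s ^ k / INR k`!.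
Proof.
have sum_ge0 ys : in01 ys -> 0 <= foldr Rplus 0 ys.
  by elim: ys => [|y ys IHys] /=; [lra|move=> /in01_cons[? /IHys]; lra].
elim: xs k s => [|x xs IHxs] k s xs01 H.
  case: k => [|k]; first by rewrite /= /Rdiv Rinv_1; lra.
  apply: Rmult_le_pos; first by apply: pow_le.
  by apply/Rlt_le/Rinv_0_lt_compat/INR_gt0/fact_gt0.
case: k => [|k]; first by rewrite /= /Rdiv Rinv_1; lra.
have [x01 xs01'] := in01_cons xs01; have Sx := sum_ge0 _ xs01'.
have Hs : foldr Rplus 0 xs <= s - x by move: H => /=; lra.
have := IHxs k.+1 _ xs01' Hs; have := IHxs k _ xs01' Hs => H1 H2.
have := @pow_fact_step (s - x) x k ltac:(lra) ltac:(lra).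
have -> : s - x + x = s by lra.
apply: Rle_trans; rewrite /=; apply: Rplus_le_compat => //.
by apply: Rmult_le_compat_l; lra.
Qed.

Lemma elsym_ones_le (T : Type) (s : seq T) k (Z : R) : INR (size s) <= Z ->
  elsym (map (fun _ => 1) s) k <= Z ^ k / INR k`!.
Proof.
move=> sZ; apply: elsym_le; first by elim: s {sZ} => [x []|i s IHs x /= [<-|/IHs]]; lra.
apply: Rle_trans sZ; elim: s => [|i s IHs]; first by rewrite /=; lra.
by rewrite -[foldr _ _ _]/(1 + foldr Rplus 0 (map (fun=> 1) s)) (S_INR (size s)); lra.
Qed.

Fixpoint bonf_terms (n : R) (b : nat) : R :=
  match b with 0%N => 1 | b'.+1 => bonf_terms n b' + n ^ b end.

Lemma bonf_terms_le n b : 0 <= n -> bonf_terms n b <= (1 + n) ^ b.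
Proof.
move=> n0; elim: b => [|b IHb] /=; first lra.
by have := pow_incr n (1 + n) b ltac:(lra); nra.
Qed.

(** * Averages over the multiples of d *)

Section Averages.
Variables (A : seq nat) (q : nat).
Hypothesis count_dvd : forall d, (0 < d)%N -> coprime d q ->
  Rabs (\rsum_(a <- A | d %| a) 1 - INR q / INR d) <= 1.

(** f behaves as if it had mean M on the multiples of every admissible d. The primes of s, on whose
    divisibility f may depend, must not divide d. *)
Definition avg (s : seq nat) (f : nat -> R) (M E : R) :=
  forall d, (0 < d)%N -> coprime d q -> (forall p, p \in s -> ~~ (p %| d)) ->
  Rabs (\rsum_(a <- A | d %| a) f a - INR q / INR d * M) <= E.

Lemma avg1 s : avg s (fun=> 1) 1 1.
Proof. by move=> d d0 dq _; rewrite Rmult_1_r; exact: count_dvd. Qed.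

Lemma avg_weaken s s' f M E E' :
  {subset s <= s'} -> E <= E' -> avg s f M E -> avg s' f M E'.
Proof.
by move=> ss EE' H d d0 dq ds; apply: Rle_trans EE'; apply: H => // p /ss; exact: ds.
Qed.

Lemma avg_ext s f g M M' E : f =1 g -> M = M' -> avg s f M E -> avg s g M' E.
Proof.
by move=> fg <- H d d0 dq ds; have := H d d0 dq ds; under eq_bigr => a _ do rewrite fg.
Qed.

Lemma avgD s f g M M' E E' : avg s f M E -> avg s g M' E' ->
  avg s (fun a => f a + g a) (M + M') (E + E').
Proof.
move=> H H' d d0 dq ds; rewrite big_split /=.
have := Rplus_le_compat _ _ _ _ (H d d0 dq ds) (H' d d0 dq ds).
by apply: Rle_trans; apply: Rle_trans (Rabs_triang _ _); apply: Req_le; f_equal; lra.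
Qed.

Lemma avgZ s f M E c : avg s f M E -> avg s (fun a => c * f a) (c * M) (Rabs c * E).
Proof.
move=> H d d0 dq ds; under eq_bigr => a _ do rewrite Rmult_comm.
have := Rmult_le_compat_l _ _ _ (Rabs_pos c) (H d d0 dq ds).
by apply: Rle_trans; rewrite rsum_mulr -Rabs_mult; apply: Req_le; f_equal; lra.
Qed.

(** Since p does not divide d, the conditions p | a and d | a combine into p d | a. *)
Lemma avg_dvd s p f M E : all prime s -> prime p -> coprime p q -> p \notin s ->
  avg s f M E -> avg (p :: s) (fun a => ind (p %| a) * f a) (/ INR p * M) E.
Proof.
move=> ps pr pq ns H d d0 dq ds.
have p0 := INR_gt0 (prime_gt0 pr); have d0' := INR_gt0 d0.
have pd : coprime p d by rewrite prime_coprime // ds // mem_head.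
have -> : \rsum_(a <- A | d %| a) (ind (p %| a) * f a) = \rsum_(a <- A | p * d %| a) f a.
  rewrite big_mkcond [RHS]big_mkcond; apply: eq_bigr => a _ /=.
  by rewrite Gauss_dvd //; case: (p %| a); case: (d %| a) => /=; lra.
have -> : INR q / INR d * (/ INR p * M) = INR q / INR (p * d) * M by rewrite INRM; field; lra.
apply: H => [||r rs]; [by rewrite muln_gt0 (prime_gt0 pr)|by rewrite coprimeMl pq|].
have pr' : prime r by exact: (allP ps).
have := ds r; rewrite in_cons rs orbT => /(_ isT) nd.
rewrite Euclid_dvdM // (negPf nd) orbF dvdn_prime2 //.
by apply/eqP => rp; rewrite -rp rs in ns.
Qed.

Definition dvs (B : seq nat) (a : nat) := [seq ind (p %| a) | p <- B].
Definition invs (B : seq nat) := [seq / INR p | p <- B].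

Definition sieving (s : seq nat) := uniq s && all (fun p => prime p && coprime p q) s.

Lemma sieving_cons p s :
  sieving (p :: s) = [&& p \notin s, prime p, coprime p q & sieving s].
Proof. by rewrite /sieving /= -!andbA; do !bool_congr. Qed.

Lemma sieving_prime s : sieving s -> all prime s.
Proof. by case/andP=> _; apply: sub_all => p /andP[]. Qed.

(** Main term and error follow the recurrence of [elsym]; on a list of ones it counts the k-subsets
    of B, each of which costs one error E. *)
Lemma avg_elsym B s f M E k : sieving (B ++ s) -> avg s f M E -> 0 <= E ->
  avg (B ++ s) (fun a => elsym (dvs B a) k * f a) (elsym (invs B) k * M)
      (elsym (map (fun=> 1) B) k * E).
Proof.
move=> + H E0; elim: B k => [|p B IHB] k.
  move=> _; case: k => [|k] /=.
    by rewrite !Rmult_1_l; apply: avg_ext H => // a; rewrite Rmult_1_l.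
  have := avgZ 0 H; rewrite Rabs_R0; exact: avg_ext.
rewrite cat_cons sieving_cons => /and4P[pB pr pq sv'].
case: k => [|k].
  have sub : {subset B ++ s <= p :: B ++ s} by move=> r; rewrite in_cons orbC => ->.
  have := avg_weaken sub (Rle_refl _) (IHB 0%N sv'); rewrite !elsym0.
  by apply: avg_ext => // a; rewrite !elsym0.
have sub : {subset B ++ s <= p :: B ++ s} by move=> r; rewrite in_cons orbC => ->.
have := avgD (avg_weaken sub (Rle_refl _) (IHB k.+1 sv'))
  (avg_dvd (sieving_prime sv') pr pq pB (IHB k sv')).
have -> : elsym (map (fun=> 1) (p :: B)) k.+1 * E =
  elsym (map (fun=> 1) B) k.+1 * E + elsym (map (fun=> 1) B) k * E by rewrite /=; lra.
by apply: avg_ext => [a|]; rewrite /=; lra.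
Qed.

Lemma avg_bonf B s f M E b Z : sieving (B ++ s) -> avg s f M E -> 0 <= E ->
  INR (size B) <= Z ->
  avg (B ++ s) (fun a => bonf (dvs B a) b * f a) (bonf (invs B) b * M) (bonf_terms Z b * E).
Proof.
move=> sv H E0 BZ; have n0 := pos_INR (size B); elim: b => [|b IHb].
  by have := avg_elsym 0 sv H E0; rewrite !elsym0; apply: avg_ext => // a; rewrite elsym0.
have := avgD IHb (avgZ ((-1) ^ b.+1) (avg_elsym b.+1 sv H E0)).
rewrite pow_1_abs Rmult_1_l => H1.
apply: (avg_ext _ _ (avg_weaken _ _ H1)) => [a||//|]; [rewrite /=; lra|rewrite /=; lra|].
rewrite /= Rmult_plus_distr_r; apply/Rplus_le_compat_l/Rmult_le_compat_r => //.
apply: Rle_trans (elsym_ones_le b.+1 BZ) _.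
have Z0 : 0 <= Z by lra.
rewrite -[Z * Z ^ b]/(Z ^ b.+1) /Rdiv -[X in _ <= X]Rmult_1_r.
apply: Rmult_le_compat_l; first exact: pow_le.
rewrite -Rinv_1; apply: Rinv_le_contravar; first lra.
exact/INR_ge1/fact_gt0.
Qed.

End Averages.

(** * Adding one block of primes to a sieve *)

Section Sieve.
Variables (A : seq nat) (q : nat).
Hypothesis count_dvd : forall d, (0 < d)%N -> coprime d q ->
  Rabs (\rsum_(a <- A | d %| a) 1 - INR q / INR d) <= 1.

(** Primes dividing q are left out: they never divide a number 1 + q k. *)
Definition sprimes (u v : nat) := [seq p <- index_iota u v | prime p && coprime p q].

Definition rough (v a : nat) := all (fun p => ~~ (p %| a)) (sprimes 0 v).

Definition eulerV (v : nat) := prodC (invs (sprimes 0 v)).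

Lemma mem_sprimes p u v : (p \in sprimes u v) = [&& prime p, coprime p q & (u <= p < v)%N].
Proof. by rewrite mem_filter mem_index_iota -andbA. Qed.

Lemma sprimes_cat u v w : (u <= v)%N -> (v <= w)%N -> sprimes u w = sprimes u v ++ sprimes v w.
Proof.
move=> uv vw; rewrite /sprimes /index_iota -filter_cat.
have -> : (w - u = (v - u) + (w - v))%N by rewrite addnC addnBA // subnK.
by rewrite iotaD subnKC.
Qed.

Lemma sieving_sprimes u v : (u <= v)%N -> sieving q (sprimes u v ++ sprimes 0 u).
Proof.
move=> uv; rewrite /sieving uniq_catC -sprimes_cat // filter_uniq ?iota_uniq //=.
by apply/allP => p; rewrite mem_cat !mem_sprimes => /orP[] /and3P[-> ->].
Qed.

Lemma invs01 u v : in01 (invs (sprimes u v)).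
Proof.
apply: in01_map => p; rewrite mem_sprimes => /andP[/prime_gt1/INR_ge2 p2 _].
by split; [apply/Rlt_le/Rinv_0_lt_compat|rewrite -Rinv_1; apply: Rinv_le_contravar]; lra.
Qed.

Lemma dvs01 s a : in01 (dvs s a).
Proof. by apply: in01_map => p _; split; [exact: ind_ge0|exact: ind_le1]. Qed.

Lemma prodC_dvs s a : prodC (dvs s a) = ind (all (fun p => ~~ (p %| a)) s).
Proof. by elim: s => //= p s ->; case: (p %| a) => /=; lra. Qed.

Lemma rough_split u v a : (u <= v)%N ->
  ind (rough v a) = prodC (dvs (sprimes u v) a) * ind (rough u a).
Proof.
by move=> uv; rewrite /rough (sprimes_cat _ uv) // all_cat prodC_dvs; do 2!case: all => /=; lra.
Qed.

Lemma eulerV_split u v : (u <= v)%N -> eulerV v = prodC (invs (sprimes u v)) * eulerV u.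
Proof. by move=> uv; rewrite /eulerV (sprimes_cat _ uv) // /invs map_cat prodC_cat; lra. Qed.

Lemma eulerV01 v : 0 <= eulerV v <= 1.
Proof. exact/prodC01/invs01. Qed.

(* An upper ([s] even) or lower ([s] odd) sieve for the primes below [v], with relative error
   [dl] in the main term and absolute error [E] on every residue class 0 mod [d]. *)
Definition sieve (s v : nat) (E dl : R) := exists f M,
  [/\ forall a, 0 <= (-1) ^ s * (f a - ind (rough v a)), avg A q (sprimes 0 v) f M E &
      (-1) ^ s * (M - eulerV v) <= dl * eulerV v].

Lemma sieve_weaken s v E E' dl dl' : E <= E' -> dl <= dl' -> sieve s v E dl -> sieve s v E' dl'.
Proof.
move=> EE dd [f [M [Hf HM HV]]]; exists f, M; split => //; first exact: avg_weaken HM.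
by apply: Rle_trans HV _; apply: Rmult_le_compat_r => //; case: (eulerV01 v).
Qed.

Lemma sieve_parity s s' v E dl : odd s = odd s' -> sieve s v E dl -> sieve s' v E dl.
Proof.
have sgn n : (-1) ^ n = if odd n then -1 else 1.
  by elim: n => //= n ->; case: odd => /=; lra.
by move=> ss' [f [M H]]; exists f, M; rewrite (sgn s') -ss' -sgn.
Qed.

(** The zero function is a lower sieve that loses the whole main term. *)
Lemma sieve_trivial v E : 0 <= E -> sieve 1 v E 1.
Proof.
move=> E0; exists (fun=> 0), 0; split => [a|d *|]; first by have := ind_ge0 (rough v a); rewrite /=; lra.
  by rewrite big1 // Rmult_0_r Rminus_0_r Rabs_R0.
by rewrite /=; lra.
Qed.

(** 2.02 bounds exp 0.7. Z exceeds the number of primes of the block by at least one, so that Z ^ b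
    dominates the number of terms of a truncation at order b. *)
Definition block_ok (u v : nat) (Z : R) :=
  [/\ (u <= v)%N, foldr Rplus 0 (invs (sprimes u v)) <= 0.7,
      / 2.02 <= prodC (invs (sprimes u v)) & INR (size (sprimes u v)) + 1 <= Z].

(** Bound for the k-th elementary symmetric sum of the 1 / p over a block. Dividing the first
    omitted term by the Euler product of the block gives the relative truncation error [eps b]. *)
Definition bterm (k : nat) := 0.7 ^ k / INR k`!.
Definition eps (b : nat) := 2.02 * bterm b.+1.

Lemma bterm_ge0 k : 0 <= bterm k.
Proof.
apply: Rmult_le_pos; first by apply: pow_le; lra.
by apply/Rlt_le/Rinv_0_lt_compat/INR_gt0/fact_gt0.
Qed.

Lemma bterm0 : bterm 0 = 1. Proof. by rewrite /bterm fact0 /=; lra. Qed.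

Variables (u v : nat) (Z : R).
Hypothesis uvZ : block_ok u v Z.

Local Notation B := (sprimes u v).

Let uv : (u <= v)%N. Proof. by case: uvZ. Qed.

Let sub_B : {subset B ++ sprimes 0 u <= sprimes 0 v}.
Proof. by move=> p; rewrite (sprimes_cat (leq0n u) uv) !mem_cat orbC. Qed.

Let elsym_invs k : 0 <= elsym (invs B) k <= bterm k.
Proof.
split; first exact/elsym_ge0/invs01.
by apply: elsym_le; [exact: invs01|case: uvZ].
Qed.

Let eulerV_le : eulerV u <= 2.02 * eulerV v.
Proof. by rewrite (eulerV_split uv); case: uvZ => _ _ H _; have := eulerV01 u; nra. Qed.

Let Z_ge1 : 1 <= Z.
Proof. by case: uvZ => _ _ _; have := pos_INR (size B); lra. Qed.

(** An upper sieve for the primes below u remains one for those below v; only the comparison with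
    the smaller Euler product changes. *)
Lemma step_skip E dl : 0 <= dl -> sieve 0 u E dl -> sieve 0 v E (2.02 * (1 + dl) - 1).
Proof.
move=> dl0 [f [M [Hf HM HV]]]; exists f, M; split => [a||].
- have := Hf a; rewrite (rough_split a uv) /=.
  by have := prodC01 (@dvs01 B a); have := ind_ge0 (rough u a); nra.
- apply: avg_weaken HM => [p|]; [by rewrite (sprimes_cat (leq0n u) uv) mem_cat => ->|lra].
by move: HV; rewrite /=; have := eulerV_le; nra.
Qed.

(* Brun-Hooley: the block and the smaller primes are sieved independently. *)
Lemma step_upper b E dl : ~~ odd b -> 0 <= dl -> 0 <= E -> sieve 0 u E dl ->
  sieve 0 v (Z ^ b * E) ((1 + eps b) * (1 + dl) - 1).
Proof.
move=> ob dl0 E0 [f [M [Hf HM HV]]].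
have bon xs : in01 xs -> 0 <= bonf xs b - prodC xs <= elsym xs b.+1.
  move=> /(bonferroni b); suff -> : (-1) ^ b = 1 by lra.
  by rewrite -(odd_double_half b) (negPf ob) add0n -mul2n mulnE pow_1_even.
exists (fun a => bonf (dvs B a) b * f a), (bonf (invs B) b * M); split => [a||].
- have := Hf a; rewrite (rough_split a uv) /=.
  have := bon _ (@dvs01 B a); have := ind_ge0 (rough u a); have := prodC01 (@dvs01 B a).
  by nra.
- case: (uvZ) => _ _ _ sZ; apply: avg_weaken sub_B _ (avg_bonf b (sieving_sprimes uv) HM E0 (Rle_refl _)).
  apply: Rmult_le_compat_r => //; apply: Rle_trans (bonf_terms_le b (pos_INR _)) _.
  by apply: pow_incr; have := pos_INR (size B); lra.
have [_ _ P_ge _] := uvZ; have [P0 _] := prodC01 (@invs01 u v); have [V0 _] := eulerV01 u.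
have := bon _ (@invs01 u v); have [_] := elsym_invs b.+1.
move: HV {HM}; rewrite (eulerV_split uv) /eps [(-1) ^ 0]/=.
move: (bonf _ _) (prodC _) (eulerV u) (elsym _ _) (bterm _) (bterm_ge0 b.+1) P_ge P0 V0.
move=> Y P V e t t0 P_ge P0 V0 HM et HY.
have H1 : Y <= (1 + 2.02 * t) * P by nra.
have H2 : M <= V * (1 + dl) by lra.
have H3 : Y * M <= Y * (V * (1 + dl)) by apply: Rmult_le_compat_l; lra.
have H4 : Y * (V * (1 + dl)) <= (1 + 2.02 * t) * P * (V * (1 + dl)).
  by apply: Rmult_le_compat_r H1; nra.
by lra.
Qed.

(** Let r indicate roughness below u, g the absence of primes of the block, and Y >= g the
    truncation of even order b. Then g r >= Y r - e_(b+1) r, where r is bounded below by f in the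
    first term and above by f' in the second. *)
Lemma step_lower b E E' dl dl' : ~~ odd b -> dl <= 1 -> 0 <= dl' -> 0 <= E -> 0 <= E' ->
  sieve 1 u E dl -> sieve 0 u E' dl' ->
  sieve 1 v (Z ^ b * E + Z ^ b.+1 * E') (dl + eps b * (1 + dl')).
Proof.
move=> ob dl1 dl0 E0 E0' [f [M [Hf HM HV]]] [f' [M' [Hf' HM' HV']]].
have bon xs : in01 xs -> 0 <= bonf xs b - prodC xs <= elsym xs b.+1.
  move=> /(bonferroni b); suff -> : (-1) ^ b = 1 by lra.
  by rewrite -(odd_double_half b) (negPf ob) add0n -mul2n mulnE pow_1_even.
have [_ _ P_ge sZ] := uvZ.
exists (fun a => bonf (dvs B a) b * f a + -1 * (elsym (dvs B a) b.+1 * f' a)),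
  (bonf (invs B) b * M + -1 * (elsym (invs B) b.+1 * M')); split => [a||].
- have := Hf a; have := Hf' a; rewrite (rough_split a uv) /=.
  have := bon _ (@dvs01 B a); have := ind_ge0 (rough u a); have := prodC01 (@dvs01 B a).
  by nra.
- apply: avgD.
    apply: avg_weaken sub_B _ (avg_bonf b (sieving_sprimes uv) HM E0 (Rle_refl _)).
    apply: Rmult_le_compat_r => //; apply: Rle_trans (bonf_terms_le b (pos_INR _)) _.
    by apply: pow_incr; have := pos_INR (size B); lra.
  have := avgZ (-1) (avg_elsym b.+1 (sieving_sprimes uv) HM' E0').
  apply: avg_weaken sub_B _; rewrite Rabs_Ropp Rabs_R1 Rmult_1_l.
  apply: Rmult_le_compat_r => //.
  have sZ' : INR (size B) <= Z by lra.
  apply: Rle_trans (elsym_ones_le b.+1 sZ') _.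
  apply: (Rmult_le_reg_r (INR b.+1`!)); first exact/INR_gt0/fact_gt0.
  rewrite /Rdiv Rmult_assoc Rinv_l; last by have := INR_gt0 (fact_gt0 b.+1); lra.
  have := pow_le Z b.+1 ltac:(lra); have := @INR_ge1 b.+1`! (fact_gt0 _); nra.
have [P0 _] := prodC01 (@invs01 u v); have [V0 _] := eulerV01 u.
have := bon _ (@invs01 u v); have := elsym_invs b.+1.
move: HV HV'; rewrite (eulerV_split uv) /eps [(-1) ^ 0]/= [(-1) ^ 1]/=.
move: (bonf _ _) (prodC _) (eulerV u) (elsym _ _) (bterm _) (bterm_ge0 b.+1) P_ge P0 V0.
move=> Y P V e t t0 P_ge P0 V0 HM1 HM2 et HY.
have H1 : V * (1 - dl) <= M by lra.
have H2 : M' <= V * (1 + dl') by lra.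
have H3 : P * (V * (1 - dl)) <= Y * M.
  by apply: Rmult_le_compat => //; [apply: Rmult_le_pos; lra|lra].
have H4 : e * M' <= (2.02 * t * P) * (V * (1 + dl')).
  apply: Rle_trans (_ : _ <= e * (V * (1 + dl'))) _; first by apply: Rmult_le_compat_l; lra.
  by apply: Rmult_le_compat_r; [nra|nra].
by lra.
Qed.

(* [1_block * r = sum_i (-1)^i e_i r], with [r] replaced by upper and lower sieves alternately. *)
Lemma step_alt b (E : nat -> R) (dl : nat -> R) E' :
  (forall i, (i <= b)%N ->
     [/\ sieve (b + i) u (E i) (dl i), 0 <= dl i, 0 <= E i & Z ^ i * E i <= E']) ->
  sieve b v (INR b.+1 * E')
    (2.02 * (bterm b.+1 + \rsum_(i <- index_iota 0 b.+1) (bterm i * dl i))).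
Proof.
move=> H; have [_ _ P_ge sZ] := uvZ.
have {}sZ : INR (size B) <= Z by lra.
have E0' : 0 <= E'.
  by have [_ _ E00] := H 0%N isT; rewrite /= Rmult_1_l; lra.
have cntE i : (i <= b)%N -> elsym (map (fun=> 1) B) i * E i <= E'.
  move=> /H[_ _ Ei0]; apply: Rle_trans; apply: Rmult_le_compat_r => //.
  apply: Rle_trans (elsym_ones_le i sZ) _.
  apply: (Rmult_le_reg_r (INR i`!)); first exact/INR_gt0/fact_gt0.
  rewrite /Rdiv Rmult_assoc Rinv_l; last by have := INR_gt0 (fact_gt0 i); lra.
  have := pow_le Z i ltac:(lra); have := @INR_ge1 i`! (fact_gt0 _); nra.
have [V0 _] := eulerV01 u.
(* The term (-1)^i e_i r, multiplied by the sign (-1)^b, must be bounded above, hence a sieve of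
   parity b + i is used for it. *)
have partial j : (j <= b)%N -> exists F M,
  [/\ forall a, 0 <= (-1) ^ b * (F a - bonf (dvs B a) j * ind (rough u a)),
      avg A q (sprimes 0 v) F M (INR j.+1 * E') &
      (-1) ^ b * (M - bonf (invs B) j * eulerV u) <=
        (\rsum_(i <- index_iota 0 j.+1) (bterm i * dl i)) * eulerV u].
  elim: j => [_|j IHj jb].
    have [[f [M [Hf HM HV]]] _ E00 _] := H 0%N isT; rewrite addn0 in Hf HV.
    exists f, M; split => [a||]; first by have := Hf a; rewrite /= Rmult_1_l.
      apply: avg_weaken HM => [p|]; first by rewrite (sprimes_cat (leq0n u) uv) mem_cat => ->.
      by have := cntE 0%N isT; rewrite elsym0 /=; lra.
    by rewrite /index_iota big_cons big_nil bterm0 [bonf _ 0]/=; move: HV; lra.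
  have [F [M [HF HM HV]]] := IHj (ltnW jb).
  have [[f' [M' [Hf' HM' HV']]] dl0 Ej0 _] := H _ jb.
  exists (fun a => F a + (-1) ^ j.+1 * (elsym (dvs B a) j.+1 * f' a)),
    (M + (-1) ^ j.+1 * (elsym (invs B) j.+1 * M')); split => [a||].
  - have := Hf' a; rewrite pow_add; have := HF a.
    have := elsym_ge0 j.+1 (@dvs01 B a); rewrite [bonf _ j.+1]/=.
    move: (elsym _ _) (ind _) (bonf _ _) (f' a) (F a) ((-1) ^ b) => e r y h g s.
    rewrite -[-1 * (-1) ^ j]/((-1) ^ j.+1); move: ((-1) ^ j.+1) => s' e0 H1 H2.
    have := Rmult_le_pos _ _ e0 H2; nra.
  - have := avgD HM (avgZ ((-1) ^ j.+1)
      (avg_weaken sub_B (cntE _ jb) (avg_elsym j.+1 (sieving_sprimes uv) HM' Ej0))).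
    by rewrite pow_1_abs (S_INR j.+1) Rmult_plus_distr_r; apply: avg_ext.
  rewrite big_nat_recr // [bonf _ j.+1]/=.
  rewrite -[-1 * (-1) ^ j]/((-1) ^ j.+1).
  have [e0 e1] := elsym_invs j.+1; rewrite pow_add in HV'.
  have := Rmult_le_compat_l _ _ _ e0 HV'.
  have : elsym (invs B) j.+1 * (dl j.+1 * eulerV u) <= bterm j.+1 * (dl j.+1 * eulerV u).
    by apply: Rmult_le_compat_r => //; apply: Rmult_le_pos.
  move=> H1 H2; rewrite -[X in _ <= X * _]/(\rsum_(i <- index_iota 0 j.+1) (bterm i * dl i) +
    bterm j.+1 * dl j.+1).
  by move: HV H1 H2; lra.
have [F [M [HF HM HV]]] := partial b (leqnn b).
exists F, M; split => // [a|].
  have := HF a; have := bonferroni b (@dvs01 B a); rewrite (rough_split a uv).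
  by move=> [H1 _]; have := Rmult_le_pos _ _ H1 (ind_ge0 (rough u a)); lra.
have [H1 H2] := bonferroni b (@invs01 u v); have [_ e1] := elsym_invs b.+1.
have sum0 : 0 <= \rsum_(i <- index_iota 0 b.+1) (bterm i * dl i).
  rewrite big_seq; apply: rsum_ge0 => i; rewrite mem_index_iota ltnS => /H[_ d0 _ _].
  exact: Rmult_le_pos (bterm_ge0 i) d0.
have := Rmult_le_compat_r _ _ _ V0 (Rle_trans _ _ _ H2 e1).
have t0 := bterm_ge0 b.+1; have := eulerV_le; move: HV.
have -> : eulerV v = prodC (invs B) * eulerV u by rewrite -eulerV_split.
move: (\rsum_(_ <- _) _) sum0 (bterm b.+1) t0 (prodC _) => S S0 t t0 P HV VV H3.
have : (t + S) * eulerV u <= (t + S) * (2.02 * (P * eulerV u)).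
  by apply: Rmult_le_compat_l; lra.
lra.
Qed.

End Sieve.

(** * The sieve for small primes *)

Lemma foldr_rsum (s : seq nat) (g : nat -> R) :
  foldr Rplus 0 (map g s) = \rsum_(p <- s) g p.
Proof. by rewrite foldrE big_map. Qed.

Lemma invs_block_le q u v :
  foldr Rplus 0 (invs (sprimes q u v)) <= \rsum_(p <- index_iota u v | prime p) / (INR p - 1).
Proof.
rewrite /invs foldr_rsum /sprimes big_filter.
have i0 p : prime p -> 0 < / (INR p - 1).
  by move=> /prime_gt1/INR_ge2 p2; apply: Rinv_0_lt_compat; lra.
apply: Rle_trans (@ler_rsum_sub _ _ (fun p => prime p && coprime p q) prime _ _ _).
- apply: ler_rsum => p /andP[/prime_gt1/INR_ge2 p2 _]; apply: Rinv_le_contravar; lra.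
- by move=> p /andP[].
- by move=> p /i0; lra.
Qed.

(** 1 - 1 / p is the inverse of 1 + 1 / (p - 1), which is at most exp (1 / (p - 1)); this is why the
    block sums use p - 1. *)
Lemma prodC_invs_exp s : all prime s ->
  exp (- \rsum_(p <- s) / (INR p - 1)) <= prodC (invs s).
Proof.
elim: s => [_|p s IHs /andP[/prime_gt1/INR_ge2 p2 /IHs H]]; first by rewrite big_nil Ropp_0 exp_0 /=; lra.
rewrite big_cons Ropp_plus_distr exp_plus; apply: Rmult_le_compat H; try exact/Rlt_le/exp_pos.
have i0 : 0 < / (INR p - 1) by apply: Rinv_0_lt_compat; lra.
rewrite exp_Ropp (_ : 1 - / INR p = / (1 + / (INR p - 1))); last by field; lra.
by apply: Rinv_le_contravar; [lra|exact: exp_ineq1_le].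
Qed.

Lemma size_sprimes q u v : (1 < v)%N -> (size (sprimes q u v) + 2 <= v)%N.
Proof.
move=> v1; rewrite -[X in (_ <= X)%N](subnK v1) leq_add2r.
rewrite -(size_iota 2 (v - 2)); apply: uniq_leq_size; first by rewrite filter_uniq ?iota_uniq.
by move=> p; rewrite mem_sprimes mem_iota subnKC // => /and3P[/prime_gt1 -> _ /andP[_ ->]].
Qed.

Lemma block_cl q t : 2000000 <= t -> block_ok q (cl (t / 2)) (cl t) (exp t).
Proof.
move=> t0; have H := sum_inv_block t0; split.
- by apply: cl_le; lra.
- exact: Rle_trans (invs_block_le _ _ _) H.
- have pr : all prime (sprimes q (cl (t / 2)) (cl t)).
    by apply/allP => p; rewrite mem_sprimes => /andP[].
  apply: Rle_trans (prodC_invs_exp pr).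
  apply: Rle_trans (_ : _ <= exp (Ropp 0.7)) _.
    by rewrite exp_Ropp; apply: Rinv_le_contravar; [exact: exp_pos|exact: exp_07].
  have : Ropp 0.7 <= - \rsum_(p <- sprimes q (cl (t / 2)) (cl t)) / (INR p - 1).
    apply: Ropp_le_contravar; apply: Rle_trans H; rewrite big_filter; apply: ler_rsum_sub.
      by move=> p /andP[].
    by move=> p /prime_gt1/INR_ge2 p2; apply/Rlt_le/Rinv_0_lt_compat; lra.
  by case=> [/exp_increasing|->]; lra.
have c2 : (1 < cl t)%N by apply: cl_ge2; lra.
have := ler_INR (size_sprimes q (cl (t / 2)) c2); rewrite INRD.
by have [_] := cl_spec t; rewrite (_ : INR 2 = 2) //; lra.
Qed.

Lemma btermS k : bterm k.+1 = bterm k * (0.7 / INR k.+1).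
Proof.
rewrite /bterm factS INRM -[0.7 ^ k.+1]/(0.7 * 0.7 ^ k); have := INR_gt0 (fact_gt0 k); have := @INR_gt0 k.+1 isT.
by move=> *; field; lra.
Qed.

Lemma eps_step b : (4 <= b)%N -> eps b.+2 <= eps b / 50.
Proof.
move=> b4; rewrite /eps !(btermS b.+2) (btermS b.+1).
have t0 := bterm_ge0 b.+1; have b6 : 6 <= INR b.+2 by have := ler_INR b4; rewrite !S_INR [INR 0]/=; lra.
have H n : 6 <= n -> 0 <= 0.7 / n <= 0.12.
  move=> n6; have : / n <= / 6 by apply: Rinv_le_contravar; lra.
  by have : 0 < / n; [apply: Rinv_0_lt_compat; lra|lra].
have := H _ b6; have := H (INR b.+3) ltac:(rewrite (S_INR b.+2); lra).
move: (0.7 / INR b.+2) (0.7 / INR b.+3) (bterm _) t0 => x y t t0 y01 x01.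
by have : x * y <= 0.02; nra.
Qed.

Lemma eps_ge0 b : 0 <= eps b.
Proof. by rewrite /eps; have := bterm_ge0 b.+1; lra. Qed.

Lemma eps4 : eps 4 <= 0.00283.
Proof. by rewrite /eps !btermS bterm0 /=; lra. Qed.

Lemma expX x k : exp x ^ k = exp (INR k * x).
Proof.
elim: k => [|k IHk]; first by rewrite /= Rmult_0_l exp_0.
by rewrite -[LHS]/(exp x * exp x ^ k) IHk -exp_plus S_INR; f_equal; lra.
Qed.

Section InnerSieve.
Variables (A : seq nat) (q : nat).
Hypothesis count_dvd : forall d, (0 < d)%N -> coprime d q ->
  Rabs (\rsum_(a <- A | d %| a) 1 - INR q / INR d) <= 1.

(** Full inclusion-exclusion: no error in the main term, but 2 ^ size B absolute errors. It is
    affordable only below a fixed bound, where it starts the recursion. *)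
Lemma avg_exact B s f M E : sieving q (B ++ s) -> avg A q s f M E -> 0 <= E ->
  avg A q (B ++ s) (fun a => prodC (dvs B a) * f a) (prodC (invs B) * M) (2 ^ size B * E).
Proof.
move=> + H E0; elim: B => [_|p B IHB].
  by rewrite /= !Rmult_1_l; apply: avg_ext H => // a; rewrite Rmult_1_l.
rewrite cat_cons sieving_cons => /and4P[pB pr pq sv'].
have sub : {subset B ++ s <= p :: B ++ s} by move=> r; rewrite in_cons orbC => ->.
have := avgD (avg_weaken sub (Rle_refl _) (IHB sv'))
  (avgZ (-1) (avg_dvd (sieving_prime sv') pr pq pB (IHB sv'))).
rewrite Rabs_Ropp Rabs_R1.
have -> : 2 ^ size B * E + 1 * (2 ^ size B * E) = 2 ^ size (p :: B) * E by rewrite /=; lra.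
by apply: avg_ext => [a|]; rewrite /=; lra.
Qed.

Lemma sieve_exact s v : sieve A q s v (2 ^ v) 0.
Proof.
exists (fun a => prodC (dvs (sprimes q 0 v) a) * 1), (prodC (invs (sprimes q 0 v)) * 1); split => [a||].
- by rewrite prodC_dvs /rough Rmult_1_r Rminus_diag Rmult_0_r; lra.
- have sv : sieving q (sprimes q 0 v ++ [::]) by have := @sieving_sprimes q 0 v isT; rewrite /sprimes /index_iota.
  have := avg_exact sv (@avg1 _ _ count_dvd [::]) Rle_0_1; rewrite cats0.
  apply: avg_weaken => //; rewrite Rmult_1_r; apply: Rle_pow; first lra.
  by apply/leP; rewrite size_filter (leq_trans (count_size _ _)) // size_iota subn0.
by rewrite /eulerV Rmult_1_r Rminus_diag Rmult_0_r; lra.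
Qed.

Lemma eulerV_ge_pow v : / 2 ^ v <= eulerV q v.
Proof.
apply: Rle_trans (_ : _ <= / 2 ^ size (sprimes q 0 v)) _.
  apply: Rinv_le_contravar; first by apply: pow_lt; lra.
  apply: Rle_pow; first lra.
  by apply/leP; rewrite size_filter (leq_trans (count_size _ _)) // size_iota subn0.
rewrite /eulerV; have : forall p, p \in sprimes q 0 v -> prime p by move=> p; rewrite mem_sprimes => /andP[].
elim: (sprimes q 0 v) => [_|p s IHs H]; first by rewrite /= Rinv_1; lra.
rewrite [_ ^ _]/= Rinv_mult; apply: Rmult_le_compat; first lra.
- by apply/Rlt_le/Rinv_0_lt_compat/pow_lt; lra.
- have /prime_gt1/INR_ge2 p2 : prime p by apply: H; rewrite mem_head.
  by have : / INR p <= / 2; [apply: Rinv_le_contravar; lra|lra].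
by apply: IHs => r rs; apply: H; rewrite in_cons rs orbT.
Qed.

Definition Kin : R := 2 ^ cl 2000000.

Lemma Kin_ge1 : 1 <= Kin.
Proof. by apply: pow_R1_Rle; lra. Qed.

(* Each time the block ]exp (t/2), exp t] is halved (in [t]) the truncation order [b] grows by 2:
   the levels [b t + (b + 2) t / 2 + ...] stay bounded while the errors decrease
   superexponentially. *)
Lemma inner_sieve n t b : 1000000 <= t -> t < 2 ^ n * 2000000 -> ~~ odd b -> (4 <= b)%N ->
  [/\ sieve A q 0 (cl t) (Kin * exp ((2 * INR b + 4) * t)) (1.03 * eps b),
      sieve A q 1 (cl t) (2 * Kin * exp ((2 * INR b + 5) * t)) (1.03 * eps b) &
      / (Kin * t ^ 2) <= eulerV q (cl t)].
Proof.
have K1 := Kin_ge1.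
elim: n t b => [|n IHn] t b t1 tn ob b4.
  have le2 : 2 ^ cl t <= Kin.
    by apply: Rle_pow; [lra|apply/leP/cl_le; move: tn => /=; lra].
  have e1 x : 0 <= x -> 1 <= exp x by have := exp_ineq1_le x; lra.
  have d0 : 0 <= 1.03 * eps b by have := eps_ge0 b; lra.
  have b0 := pos_INR b.
  have E1 := e1 ((2 * INR b + 4) * t) ltac:(nra).
  have E2 := e1 ((2 * INR b + 5) * t) ltac:(nra).
  split.
  - by apply: sieve_weaken d0 (sieve_exact 0 _); nra.
  - by apply: sieve_weaken d0 (sieve_exact 1 _); nra.
  apply: Rle_trans (eulerV_ge_pow _); apply: Rinv_le_contravar; first by apply: pow_lt; lra.
  by have : 1 <= t ^ 2; [rewrite /=; nra|nra].
have [t2|t2] := Rlt_le_dec t 2000000; first by apply: (IHn t b) => //; have := pow_R1_Rle 2 n; lra.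
have ob2 : ~~ odd b.+2 by rewrite /= negbK.
have [] := IHn (t / 2) b.+2 ltac:(lra) _ ob2 (leqW (leqW b4)); first by move: tn => /=; lra.
have blk := block_cl q t2.
have s4 := eps_step b4; have e40 := eps_ge0 b; have e20 := eps_ge0 b.+2.
have eb : eps b <= 0.003.
  have H k : eps k.+1 <= eps k.
    rewrite /eps (btermS k.+1); have := bterm_ge0 k.+1.
    have : 0.7 / INR k.+2 <= 1.
      have := @INR_ge1 k.+2 isT => k1.
      by have : / INR k.+2 <= 1; [rewrite -Rinv_1; apply: Rinv_le_contravar; lra|lra].
    by move: (0.7 / INR k.+2) (bterm k.+1) => x y; nra.
  apply: Rle_trans (_ : eps 4 <= _); last by have := eps4; lra.
  rewrite -(subnKC b4); elim: (b - 4)%N => [|k IHk]; first by rewrite addn0; lra.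
  by rewrite addnS; apply: Rle_trans (H _) IHk.
(* [eps b.+2] is at most [eps b / 50], so all later blocks together add less than 3 percent of
   [eps b]. *)
have dd : (1 + eps b) * (1 + 1.03 * eps b.+2) - 1 <= 1.03 * eps b by nra.
have dd' : 1.03 * eps b.+2 + eps b * (1 + 1.03 * eps b.+2) <= 1.03 * eps b by nra.
have K0 : 0 <= Kin by lra.
rewrite !S_INR => HU HL HV; split.
- apply: sieve_weaken dd (step_upper blk ob _ _ HU); try lra.
    rewrite expX; apply: Req_le.
    (* The exponent (2 b + 4) t solves the recursion L(b, t) = b t + L(b + 2, t / 2). *)
    rewrite (_ : (2 * INR b + 4) * t = INR b * t + (2 * (INR b + 1 + 1) + 4) * (t / 2)); last by field.
    by rewrite exp_plus; lra.
  by apply: Rmult_le_pos => //; apply/Rlt_le/exp_pos.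
- apply: sieve_weaken dd' (step_lower blk ob _ _ _ _ HL HU); try lra.
  + rewrite !expX S_INR.
    (* The first error has exponent (2 b + 4.5) t, thus a spare factor exp (- t / 2) <= 1 / 2, and
       the second has (2 b + 5) t; together they are at most Kin + Kin times the target
       exponential. *)
    have -> : exp (INR b * t) * (2 * Kin * exp ((2 * (INR b + 1 + 1) + 5) * (t / 2))) =
        2 * Kin * (exp ((2 * INR b + 5) * t) * exp (- (t / 2))).
      rewrite (_ : exp (INR b * t) * _ = 2 * Kin * (exp (INR b * t) * exp ((2 * (INR b + 1 + 1) + 5) * (t / 2)))); last lra.
      by rewrite -!exp_plus; do 2!f_equal; field.
    have -> : exp ((INR b + 1) * t) * (Kin * exp ((2 * (INR b + 1 + 1) + 4) * (t / 2))) =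
        Kin * exp ((2 * INR b + 5) * t).
      rewrite (_ : exp ((INR b + 1) * t) * _ = Kin * (exp ((INR b + 1) * t) * exp ((2 * (INR b + 1 + 1) + 4) * (t / 2)))); last lra.
      by rewrite -!exp_plus; do 2!f_equal; field.
    have : exp (- (t / 2)) <= / 2.
      by rewrite exp_Ropp; apply: Rinv_le_contravar; [lra|have := exp_ineq1_le (t / 2); lra].
    have := exp_pos ((2 * INR b + 5) * t).
    move: (exp ((2 * INR b + 5) * t)) (exp (- (t / 2))) => x y x0 y2.
    have : Kin * (x * y) <= Kin * (x * / 2).
      by apply: Rmult_le_compat_l => //; apply: Rmult_le_compat_l; lra.
    lra.
  + by repeat apply: Rmult_le_pos => //; [lra|apply/Rlt_le/exp_pos].
  + by repeat apply: Rmult_le_pos => //; apply/Rlt_le/exp_pos.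
have uv : (cl (t / 2) <= cl t)%N by apply: cl_le; lra.
rewrite (eulerV_split q uv); case: blk => _ _ P _.
have V0 : 0 < / (Kin * (t / 2) ^ 2).
  by apply/Rinv_0_lt_compat/Rmult_lt_0_compat; [lra|apply: pow_lt; lra].
(* One block divides the Euler product by at most 2.02, while halving t divides t ^ 2 by 4. *)
have : / (Kin * t ^ 2) = / 4 * / (Kin * (t / 2) ^ 2) by field; lra.
by nra.
Qed.

End InnerSieve.

(** * Certified numerical errors of the outer sieves *)

(** Errors are computed as integers in units of 10^-6; every inexact operation rounds up, so the
    computed values are true upper bounds. *)
Definition micro (d : Z) : R := IZR d / 1000000.

Lemma ceil_div_ge a m : (0 < m)%Z -> IZR a / IZR m <= IZR (a / m + 1).
Proof.
move=> m0; have m0' : 0 < IZR m by apply: IZR_lt.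
have := Z.mod_pos_bound a m m0; have := Z.div_mod a m ltac:(lia).
rewrite plus_IZR; set d := (_ / _)%Z; set r := (_ mod _)%Z => /(f_equal IZR).
rewrite plus_IZR mult_IZR => E [_ /IZR_lt r1].
by apply: (Rmult_le_reg_r (IZR m)) => //; rewrite /Rdiv Rmult_assoc Rinv_l; lra.
Qed.

Definition mulz (a b : Z) : Z := (a * b / 1000000 + 1)%Z.

Arguments mulz : simpl never.

Lemma mulz_ge a b : micro a * micro b <= micro (mulz a b).
Proof.
have := @ceil_div_ge (a * b) 1000000 ltac:(lia).
by rewrite mult_IZR -/(mulz a b) /micro; lra.
Qed.

Lemma mulz_ge0 a b : (0 <= a)%Z -> (0 <= b)%Z -> (0 <= mulz a b)%Z.
Proof. by move=> a0 b0; rewrite /mulz; have := Z.div_pos (a * b) 1000000; lia. Qed.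

Definition btermz (k : nat) : Z := (7 ^ Z.of_nat k * 1000000 / (10 ^ Z.of_nat k * Z.of_nat k`!) + 1)%Z.

Arguments btermz : simpl never.

Lemma btermz_ge k : bterm k <= micro (btermz k).
Proof.
have k0 : (0 < Z.of_nat k`!)%Z by have /ltP := fact_gt0 k; lia.
have t0 : (0 < 10 ^ Z.of_nat k)%Z by apply: Z.pow_pos_nonneg; lia.
have := @ceil_div_ge (7 ^ Z.of_nat k * 1000000) (10 ^ Z.of_nat k * Z.of_nat k`!) ltac:(lia).
rewrite /micro /btermz; set z := IZR (_ + 1); rewrite !mult_IZR -!pow_IZR -INR_IZR_INZ /bterm.
have := INR_gt0 (fact_gt0 k); have := pow_lt 10 k ltac:(lra).
rewrite (_ : 0.7 = 7 * / 10); last lra.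
rewrite Rpow_mult_distr pow_inv; move: (7 ^ k) (10 ^ k) (INR k`!) => x y f y0 f0 H.
rewrite (_ : x * / y / f = x * 1000000 / (y * f) / 1000000); first lra.
by field; lra.
Qed.

Lemma btermz_ge0 k : (0 <= btermz k)%Z.
Proof.
apply: le_IZR; have := btermz_ge k; have := bterm_ge0 k; rewrite /micro; lra.
Qed.

(** [None] means that no bound is available and acts as plus infinity. *)
Definition omin (a b : option Z) : option Z :=
  match a, b with
  | Some x, Some y => Some (Z.min x y)
  | None, _ => b
  | _, None => a
  end.

Fixpoint alt_sum (g : nat -> option Z) (j : nat) : option Z :=
  match j with
  | 0%N => omap (mulz (btermz 0)) (g 0%N)
  | j'.+1 => obind (fun s => omap (fun d => (s + mulz (btermz j) d)%Z) (g j)) (alt_sum g j')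
  end.

(** Fixed-point form of the error in [step_alt]; the parity of b + i selects the lower or the upper
    sieve. *)
Definition alt_error (b : nat) (up lo : nat -> option Z) : option Z :=
  omap (fun s => mulz 2020000 (btermz b.+1 + s))
    (alt_sum (fun i => if odd (b + i) then lo i else up i) b).

Definition epsz (b : nat) : Z := mulz 2020000 (btermz b.+1).

Arguments epsz : simpl never.

Definition skip_error (u : option Z) : option Z :=
  omap (fun d => (mulz 2020000 (1000000 + d) - 1000000)%Z) u.

Definition upper_error (b : nat) (u : option Z) : option Z :=
  omap (fun d => (mulz (1000000 + epsz b) (1000000 + d) - 1000000)%Z) u.

Definition lower_error (b : nat) (l u : option Z) : option Z :=
  obind (fun d => omap (fun d' => (d + mulz (epsz b) (1000000 + d'))%Z) u) l.

(* Given the errors [t i] of the sieves of level reduced by [i] times the new block, the best of the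
   available steps ([step_skip], [step_upper], [step_lower], [step_alt]). The pair
   [(None, 1000000)] stands for no upper sieve and the trivial lower sieve. *)
Definition error_step (t : nat -> option Z * Z) : option Z * Z :=
  let r := [seq t i | i <- iota 0 6] in
  let up i := (nth (None, 1000000%Z) r i).1 in
  let lo i := Some (nth (None, 1000000%Z) r i).2 in
  (omin (omin (skip_error (up 0%N)) (upper_error 4 (up 4%N)))
        (omin (alt_error 2 up lo) (alt_error 4 up lo)),
   odflt 1000000%Z (omin (Some 1000000%Z)
     (omin (lower_error 4 (lo 4%N) (up 5%N)) (alt_error 3 up lo)))).

(* The value 2915 bounds 10^6 * 1.03 * eps 4, the error of [inner_sieve]. Entry [D] of row [n]
   holds certified relative errors, in units of 10^-6, of an upper and a lower sieve of level
   [exp (D h)] for the primes up to [exp (2 ^ n * h / 2)]. *)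
Fixpoint error_row (n : nat) : seq (option Z * Z) :=
  match n with
  | 0%N => [seq (if (6 <= D)%N then Some 2915%Z else None,
                 if (7 <= D)%N then 2915%Z else 1000000%Z) | D <- iota 0 132]
  | n'.+1 => let r := error_row n' in
    [seq error_step (fun i => if (i * 2 ^ n' <= D)%N
       then nth (None, 1000000%Z) r (D - i * 2 ^ n') else (None, 1000000%Z)) | D <- iota 0 132]
  end.

Definition sieve_error n D := nth (None, 1000000%Z) (error_row n) D.

(** * Soundness of the table of errors *)

Section OuterSieve.
Variables (A : seq nat) (q : nat).
Hypothesis count_dvd : forall d, (0 < d)%N -> coprime d q ->
  Rabs (\rsum_(a <- A | d %| a) 1 - INR q / INR d) <= 1.
Variable h : R.
Hypothesis h_large : 2000000 <= h.

Definition good_error s v E (o : option Z) :=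
  forall d, o = Some d -> (0 <= d)%Z /\ sieve A q s v E (micro d).

Lemma good_omin s v E a b : good_error s v E a -> good_error s v E b -> good_error s v E (omin a b).
Proof.
case: a b => [x|] [y|] //= Ha Hb d [<-].
by case: (Z.min_spec x y) => [[_ ->]|[_ ->]]; [exact: Ha|exact: Hb].
Qed.

Lemma good_weaken s v E E' o : E <= E' -> good_error s v E o -> good_error s v E' o.
Proof.
by move=> EE H d /H[d0 Hd]; split=> //; apply: sieve_weaken EE (Rle_refl _) Hd.
Qed.

Lemma micro_ge0 d : (0 <= d)%Z -> 0 <= micro d.
Proof. by move/IZR_le; rewrite /micro; lra. Qed.

Lemma microD a b : micro (a + b) = micro a + micro b.
Proof. by rewrite /micro plus_IZR; lra. Qed.

Lemma epsz_ge b : eps b <= micro (epsz b).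
Proof.
apply: Rle_trans (mulz_ge _ _); rewrite /eps (_ : micro 2020000 = 2.02); last by rewrite /micro; lra.
by apply: Rmult_le_compat_l (btermz_ge _); lra.
Qed.

Section OneBlock.
Variables (u v : nat) (Z : R).
Hypothesis uvZ : block_ok q u v Z.

Lemma good_skip E o : good_error 0 u E o -> good_error 0 v E (skip_error o).
Proof.
case: o => [x|] H d; last by [].
move=> /Some_inj <-; have [x0 Hx] := H _ erefl; have x0' := micro_ge0 x0.
have Hm := mulz_ge 2020000 (1000000 + x).
have E1 : micro 2020000 * micro (1000000 + x) = 2.02 * (1 + micro x) by rewrite microD /micro; lra.
have E2 : micro (mulz 2020000 (1000000 + x) - 1000000) = micro (mulz 2020000 (1000000 + x)) - 1.
  by rewrite /micro minus_IZR; lra.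
split; last by apply: sieve_weaken (Rle_refl _) _ (step_skip uvZ x0' Hx); lra.
by apply: le_IZR; have : 0 <= micro (mulz 2020000 (1000000 + x) - 1000000); rewrite /micro; [rewrite -/(micro _); lra|lra].
Qed.

Lemma good_upper b E o : ~~ odd b -> 0 <= E ->
  good_error 0 u E o -> good_error 0 v (Z ^ b * E) (upper_error b o).
Proof.
move=> ob E0; case: o => [x|] H d; last by [].
move=> /Some_inj <-; have [x0 Hx] := H _ erefl; have x0' := micro_ge0 x0.
have Hm := mulz_ge (1000000 + epsz b) (1000000 + x).
have He := epsz_ge b; have e0 := eps_ge0 b.
have E1 : micro (1000000 + epsz b) * micro (1000000 + x) = (1 + micro (epsz b)) * (1 + micro x).
  by rewrite !microD (_ : micro 1000000 = 1) // /micro; lra.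
set m := mulz _ _ in Hm *.
have E2 : micro (m - 1000000) = micro m - 1 by rewrite /micro minus_IZR; lra.
have H1 : (1 + eps b) * (1 + micro x) <= micro m.
  by apply: Rle_trans Hm; rewrite E1; apply: Rmult_le_compat_r; lra.
have H2 : 0 <= eps b * micro x by apply: Rmult_le_pos.
split; last by apply: sieve_weaken (Rle_refl _) _ (step_upper uvZ ob x0' E0 Hx); lra.
by apply: le_IZR; have : 0 <= micro (m - 1000000); [lra|rewrite /micro; lra].
Qed.

Lemma good_lower b E E' l o : ~~ odd b -> 0 <= E -> 0 <= E' ->
  (forall d, l = Some d -> (d <= 1000000)%Z) ->
  good_error 1 u E l -> good_error 0 u E' o ->
  good_error 1 v (Z ^ b * E + Z ^ b.+1 * E') (lower_error b l o).
Proof.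
move=> ob E0 E0'; case: l => [y|] Hy1 Hl; last by [].
case: o => [x|] Ho d; last by [].
move=> /Some_inj <-.
have [x0 Hx] := Ho _ erefl; have [y0 Hy] := Hl _ erefl; have x0' := micro_ge0 x0.
have He := epsz_ge b; have e0 := eps_ge0 b.
have e0z : (0 <= epsz b)%Z by apply: mulz_ge0 => //; exact: btermz_ge0.
split; first by have := @mulz_ge0 (epsz b) (1000000 + x) e0z ltac:(lia); lia.
have y1 : micro y <= 1 by have /IZR_le := Hy1 _ erefl; rewrite /micro; lra.
apply: sieve_weaken (Rle_refl _) _ (step_lower uvZ ob y1 x0' E0 E0' Hy Hx).
rewrite microD; apply: Rplus_le_compat_l; apply: Rle_trans (mulz_ge _ _).
by rewrite microD (_ : micro 1000000 = 1); [apply: Rmult_le_compat_r; lra|rewrite /micro; lra].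
Qed.

Lemma good_alt b (E : nat -> R) E' up lo :
  (forall i, (i <= b)%N -> [/\ good_error 0 u (E i) (up i), good_error 1 u (E i) (lo i),
     0 <= E i & Z ^ i * E i <= E']) ->
  good_error b v (INR b.+1 * E') (alt_error b up lo).
Proof.
move=> H; rewrite /alt_error; set g := fun i : nat => _.
have Hg i d : (i <= b)%N -> g i = Some d -> (0 <= d)%Z /\ sieve A q (b + i) u (E i) (micro d).
  move=> /H[Hu Hl _ _]; rewrite /g; case: ifP => odd_bi.
    by move=> /Hl[d0 Hd]; split=> //; apply: sieve_parity Hd; rewrite odd_bi.
  by move=> /Hu[d0 Hd]; split=> //; apply: sieve_parity Hd; rewrite odd_bi.
pose dl i := if g i is Some d then micro d else 0.
have sumP j s : (j <= b)%N -> alt_sum g j = Some s ->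
    [/\ (0 <= s)%Z, \rsum_(i <- index_iota 0 j.+1) (bterm i * dl i) <= micro s &
        forall i, (i <= j)%N -> exists d, g i = Some d].
  elim: j s => [|j IHj] s jb /=.
    case Eg: (g 0%N) => [d|] //= [<-]; have [d0 _] := Hg _ _ jb Eg.
    split=> [||[|i] //]; last by exists d.
      by apply: mulz_ge0 d0; exact: btermz_ge0.
    rewrite /index_iota big_cons big_nil Rplus_0_r /dl Eg.
    apply: Rle_trans (mulz_ge _ _); apply: Rmult_le_compat_r (btermz_ge 0); exact: micro_ge0.
  case Es: (alt_sum g j) => [s'|] //=; case Eg: (g j.+1) => [d|] //= [<-].
  have [s0 Hs Hall] := IHj _ (ltnW jb) Es; have [d0 _] := Hg _ _ jb Eg.
  split=> [||i].
  - by have := mulz_ge0 (@btermz_ge0 j.+1) d0; lia.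
  - rewrite big_nat_recr // microD; apply: Rplus_le_compat Hs _; rewrite /dl Eg.
    by apply: Rle_trans (mulz_ge _ _); apply: Rmult_le_compat_r (btermz_ge _); exact: micro_ge0.
  by rewrite leq_eqVlt => /orP[/eqP ->|]; [exists d|rewrite ltnS => /Hall].
case Es: (alt_sum g b) => [s|] // d /Some_inj <-; have [s0 Hs Hall] := sumP _ _ (leqnn b) Es.
split; first by apply: mulz_ge0; have := @btermz_ge0 b.+1; lia.
apply: sieve_weaken (Rle_refl _) _ (step_alt uvZ (E := E) (dl := dl) _) => [|i ib].
  apply: Rle_trans (mulz_ge _ _); rewrite microD (_ : micro 2020000 = 2.02); last by rewrite /micro; lra.
  by apply: Rmult_le_compat_l; [lra|have := btermz_ge b.+1; lra].
have [_ _ E0 EE] := H _ ib; have [d' Ed] := Hall _ ib; have [d0 Hd] := Hg _ _ ib Ed.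
by split=> //; rewrite /dl Ed //; exact: micro_ge0.
Qed.

End OneBlock.

(** 2 Kin comes from the inner lower sieve. Each further block multiplies the absolute error by at
    most 5, the number of terms of an alternating sieve of order 4. *)
Definition Kout (n : nat) : R := 2 * Kin * 5 ^ n.

Lemma Kout_ge1 n : 1 <= Kout n.
Proof. by rewrite /Kout; have := Kin_ge1; have := pow_R1_Rle 5 n; nra. Qed.

Lemma outer_sieve n D :
  [/\ good_error 0 (cl (2 ^ n * (h / 2))) (Kout n * exp (INR D * h)) (sieve_error n D).1,
      good_error 1 (cl (2 ^ n * (h / 2))) (Kout n * exp (INR D * h)) (Some (sieve_error n D).2) &
      ((sieve_error n D).2 <= 1000000)%Z].
Proof.
have trivial_error v E : 0 <= E -> good_error 1 v E (Some 1000000%Z).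
  move=> E0 d [<-]; split=> //; rewrite (_ : micro 1000000 = 1); last by rewrite /micro; lra.
  exact: sieve_trivial.
have Kexp0 m x : 0 <= Kout m * exp x by have := Kout_ge1 m; have := exp_pos x; nra.
(* Beyond the table [nth] returns its default, which claims no upper sieve and the trivial lower
   one. *)
have [lt_D|ge_D] := ltnP D 132; last first.
  have sz : size (error_row n) = 132%N by case: n => [|n]; rewrite size_map size_iota.
  by rewrite /sieve_error nth_default ?sz //; split=> //; exact: trivial_error.
elim: n D lt_D => [|n IHn] D lt_D.
  have [m hm] : exists m, h / 2 < 2 ^ m * 2000000.
    have [m Hm] := Pow_x_infinity 2 ltac:(rewrite Rabs_pos_eq; lra) (h / 2).
    exists m; have := Hm m (le_n m); rewrite Rabs_pos_eq; last by apply: pow_le; lra.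
    by have := pow_R1_Rle 2 m; lra.
  have h2 : 1000000 <= h / 2 by lra.
  have [HU HL _] := inner_sieve count_dvd h2 hm (isT : ~~ odd 4) (isT : (4 <= 4)%N).
  have ee : 1.03 * eps 4 <= micro 2915 by have := eps4; rewrite /micro; lra.
  have K1 := Kin_ge1; have i4 : INR 4 = 4 by rewrite /=; lra.
  have mono x y : x <= y -> exp x <= exp y by case=> [/exp_increasing|->]; lra.
  (* With b = 4 and t = h / 2 the inner sieves have levels exp (6 h) and exp (6.5 h), whence the
     thresholds 6 and 7. *)
  rewrite (_ : sieve_error 0 D = (if (6 <= D)%N then Some 2915%Z else None,
      if (7 <= D)%N then 2915%Z else 1000000%Z)); last first.
    by rewrite /sieve_error -[error_row 0]/(map _ _) (nth_map 0%N) ?size_iota // nth_iota.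
  rewrite /= Rmult_1_l /Kout Rmult_1_r; split.
  - case: ifP => // D6 d [<-]; split=> //; apply: sieve_weaken ee HU.
    have : exp ((2 * INR 4 + 4) * (h / 2)) <= exp (INR D * h).
      by apply: mono; rewrite i4; have := ler_INR D6; rewrite (_ : INR 6 = 6) /=; [nra|lra].
    by have := exp_pos (INR D * h); nra.
  - case: ifP => D7 d [<-]; split=> //.
      apply: sieve_weaken ee HL; apply: Rmult_le_compat_l; first lra.
      by apply: mono; rewrite i4; have := ler_INR D7; rewrite (_ : INR 7 = 7) /=; [nra|lra].
    rewrite (_ : micro 1000000 = 1); last by rewrite /micro; lra.
    by apply: sieve_trivial; have := exp_pos (INR D * h); nra.
  by case: ifP.
pose c := (2 ^ n)%N; pose X := Kout n * exp (INR D * h).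
have cE : INR c = 2 ^ n by rewrite /c INRX.
have X0 : 0 <= X by have := Kout_ge1 n; have := exp_pos (INR D * h); rewrite /X; nra.
have t2 : 2000000 <= 2 ^ n.+1 * (h / 2) by rewrite /=; have := pow_R1_Rle 2 n; nra.
have := block_cl q t2; rewrite (_ : 2 ^ n.+1 * (h / 2) / 2 = 2 ^ n * (h / 2)); last by rewrite /=; field.
set Z := exp _; set u := cl _; set v := cl _ => uvZ.
(* Here Z = exp (c h), so lowering the level by i c units compensates Z ^ i exactly: every product Z
   ^ i E i equals X. *)
pose E i := Kout n * exp ((INR D - INR i * INR c) * h).
have E0 i : 0 <= E i.
  by have := Kout_ge1 n; have := exp_pos ((INR D - INR i * INR c) * h); rewrite /E; nra.
have ZE i : Z ^ i * E i = X.
  rewrite /E /X /Z expX (_ : _ * (_ * _) = Kout n *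
    (exp (INR i * (2 ^ n.+1 * (h / 2))) * exp ((INR D - INR i * INR c) * h))); last lra.
  rewrite -exp_plus; f_equal; f_equal.
  by rewrite cE /=; field.
have X5 k : (k <= 5)%N -> INR k * X <= Kout n.+1 * exp (INR D * h).
  move=> /ler_INR; rewrite (_ : INR 5 = 5) /=; last lra.
  move=> k5; rewrite (_ : Kout n.+1 * _ = 5 * X); last by rewrite /Kout /X /Kout /=; lra.
  exact: Rmult_le_compat_r.
have W s b o : (b <= 5)%N -> good_error s v (INR b * X) o ->
    good_error s v (Kout n.+1 * exp (INR D * h)) o.
  by move=> b5; apply: good_weaken (X5 _ b5).
pose t := [seq if (i * c <= D)%N then sieve_error n (D - i * c) else (None, 1000000%Z)
  | i <- iota 0 6].
have stepE : sieve_error n.+1 D = error_step (fun i =>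
    if (i * c <= D)%N then sieve_error n (D - i * c) else (None, 1000000%Z)).
  by rewrite /sieve_error -[error_row n.+1]/(map _ _) (nth_map 0%N) ?size_iota // nth_iota.
pose up i := (nth (None, 1000000%Z) t i).1; pose lo i := Some (nth (None, 1000000%Z) t i).2.
have IH i : (i < 6)%N -> [/\ good_error 0 u (E i) (up i), good_error 1 u (E i) (lo i) &
    ((nth (None, 1000000%Z) t i).2 <= 1000000)%Z].
  move=> i6; rewrite /up /lo /t (nth_map 0%N) ?size_iota // nth_iota // add0n.
  case: leqP => [iD|_]; last by split=> //; exact: trivial_error.
  have := IHn (D - i * c)%N (leq_ltn_trans (leq_subr _ _) lt_D).
  by rewrite (_ : INR (D - i * c) = INR D - INR i * INR c) // -INRM -{2}(subnK iD) INRD; lra.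
have Halt b : (b <= 4)%N -> good_error b v (Kout n.+1 * exp (INR D * h)) (alt_error b up lo).
  move=> b4; apply: (W b b.+1) => //; apply: (good_alt uvZ (E := E)) => i ib.
  have i6 : (i < 6)%N by exact: leq_trans (leq_trans ib b4) (isT : (4 <= 5)%N).
  have [HU HL _] := IH i i6.
  by split=> //; rewrite ZE; lra.
have [HU0 _ _] := IH 0%N isT; have [HU4 HL4 le4] := IH 4%N isT; have [HU5 _ _] := IH 5%N isT.
have E0X : E 0%N = INR 1 * X by rewrite -(ZE 0%N) /= !Rmult_1_l.
have par s s' o K : odd s = odd s' -> good_error s v K o -> good_error s' v K o.
  by move=> ss H d /H[d0 Hd]; split=> //; exact: sieve_parity Hd.
have Hlow : good_error 1 v (Kout n.+1 * exp (INR D * h)) (omin (Some 1000000%Z)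
    (omin (lower_error 4 (lo 4%N) (up 5%N)) (alt_error 3 up lo))).
  apply: good_omin => [d [<-]|].
    split=> //; rewrite (_ : micro 1000000 = 1); last by rewrite /micro; lra.
    by apply: sieve_trivial; have := X5 0%N isT; rewrite /= Rmult_0_l.
  apply: good_omin; last by apply: (par 3%N) => //; exact: Halt.
  apply: (W 1%N 2%N _) => //.
  rewrite (_ : INR 2 * X = Z ^ 4 * E 4%N + Z ^ 5 * E 5%N); last by rewrite !ZE /=; lra.
  have le4' d : lo 4%N = Some d -> (d <= 1000000)%Z by case=> <-.
  exact: (@good_lower u v Z uvZ 4 _ _ _ _ isT (E0 4%N) (E0 5%N) le4' HL4 HU5).
rewrite stepE; split.
- rewrite -[(error_step _).1]/(omin (omin (skip_error (up 0%N)) (upper_error 4 (up 4%N)))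
    (omin (alt_error 2 up lo) (alt_error 4 up lo))).
  apply: good_omin; apply: good_omin.
  + by apply: (W 0%N 1%N _) => //; rewrite -E0X; exact: (@good_skip u v Z uvZ _ _ HU0).
  + apply: (W 0%N 1%N _) => //; rewrite (_ : INR 1 * X = Z ^ 4 * E 4%N); last by rewrite ZE /=; lra.
    exact: (@good_upper u v Z uvZ 4 _ _ isT (E0 4%N) HU4).
  + by apply: (par 2%N) => //; exact: Halt.
  + by apply: (par 4%N) => //; exact: Halt.
- rewrite -[(error_step _).2]/(odflt 1000000%Z (omin (Some 1000000%Z)
    (omin (lower_error 4 (lo 4%N) (up 5%N)) (alt_error 3 up lo)))).
  by move: Hlow; case: (omin (lower_error _ _ _) _).
rewrite -[(error_step _).2]/(odflt 1000000%Z (omin (Some 1000000%Z)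
    (omin (lower_error 4 (lo 4%N) (up 5%N)) (alt_error 3 up lo)))).
by case: (omin (lower_error _ _ _) _) => //= x; exact: Z.le_min_l.
Qed.

End OuterSieve.

(** Bounds 10^12 times the sum of (1/i - 1/114) (1 + error) over the blocks ]exp (i h), exp ((i+1)
    h)]. The level 130 - i makes the at most exp ((i+1) h) primes of block i cost exp (131 h) in
    total. *)
Definition row_cost (r : seq (option Z * Z)) : Z :=
  foldr (fun i c => ((zinv i - 1000000 / 114) *
    (1000000 + odflt 0 (nth (None, 1000000) r (130 - i)).1) + c)%Z) 0%Z (index_iota 16 114).

Lemma error_row_check : let r := error_row 5 in
  [&& (row_cost r <=? 1450000000000)%Z, ((nth (None, 1000000%Z) r 131).2 <=? 18000)%Z &
      all (fun i => isSome (nth (None, 1000000%Z) r (130 - i)).1) (index_iota 16 114)].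
Proof. by vm_compute. Qed.

(** * The weights *)

Lemma rsum_mem (s t : seq nat) F : uniq s -> uniq t -> {subset s <= t} ->
  \rsum_(p <- s) F p = \rsum_(p <- t | p \in s) F p.
Proof.
move=> us ut st; rewrite -[RHS]big_filter.
have st' : perm_eq s [seq p <- t | p \in s].
  apply: uniq_perm => [//||p]; first exact: filter_uniq.
  by rewrite mem_filter; case ps: (p \in s) => //=; rewrite st.
by rewrite (perm_big _ st').
Qed.

(** * Divisibility in the progression 1 + q k *)

Lemma count_window q d s : (0 < d)%N -> coprime d q ->
  count (fun k => d %| 1 + q * k) (iota s d) = 1%N.
Proof.
move=> d0 dq; pose g k := ((1 + q * k) %% d)%N.
have inj : {in iota s d &, injective g}.
  suff W k k' : (k <= k')%N -> k \in iota s d -> k' \in iota s d -> g k = g k' -> k = k'.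
    by move=> k k' ks ks' E; case: (leqP k k') => [/W|/ltnW/W] H; [|symmetry]; apply: H.
  move=> kk'; rewrite !mem_iota => ks ks' /eqP; rewrite eq_sym eqn_mod_dvd; last first.
    by rewrite leq_add2l leq_mul2l kk' orbT.
  rewrite subnDl -mulnBr Gauss_dvdr // => dk.
  apply/eqP; rewrite eqn_leq kk' -subn_eq0; apply: contraLR dk.
  rewrite -lt0n => /gtnNdvd -> //; lia.
have ug : uniq [seq g k | k <- iota s d] by rewrite map_inj_in_uniq ?iota_uniq.
have sub : {subset [seq g k | k <- iota s d] <= iota 0 d}.
  by move=> x /mapP[k _ ->]; rewrite mem_iota /= add0n ltn_mod.
have [_ E] := uniq_min_size ug sub (eq_leq (etrans (size_iota 0 d) (esym (etrans (size_map g _) (size_iota s d))))).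
have -> : count (fun k => d %| 1 + q * k) (iota s d) = count (pred1 0%N) [seq g k | k <- iota s d].
  by rewrite count_map; apply: eq_count => k.
by rewrite count_uniq_mem // E mem_iota d0.
Qed.

(** Full windows of length d contribute exactly one each; the remaining r <= d terms contribute 0 or
    1, and r / d also lies in [0, 1]. *)
Lemma count_progression q d s N : (0 < d)%N -> coprime d q ->
  Rabs (INR (count (fun k => d %| 1 + q * k) (iota s N)) - INR N / INR d) <= 1.
Proof.
move=> d0 dq; have d0' := INR_gt0 d0.
have base r s' : (r <= d)%N -> (count (fun k => d %| 1 + q * k) (iota s' r) <= 1)%N.
  move=> rd; apply: leq_trans (eq_leq (count_window s' d0 dq)).
  by rewrite -(subnKC rd) iotaD count_cat leq_addr.
rewrite (divn_eq N d); have := ltnW (ltn_pmod N d0); move: (N %/ d)%N (N %% d)%N => c r rd.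
elim: c s => [|c IHc] s.
  rewrite mul0n add0n.
  have := ler_INR (base r s rd); have := pos_INR (count (fun k => d %| 1 + q * k) (iota s r)).
  have r1 : INR r / INR d <= 1.
    by apply: (Rmult_le_reg_r (INR d)) => //; rewrite /Rdiv Rmult_assoc Rinv_l ?Rmult_1_r ?Rmult_1_l; [exact: ler_INR|lra].
  have r0 : 0 <= INR r / INR d.
    by apply: Rmult_le_pos (pos_INR _) _; apply/Rlt_le/Rinv_0_lt_compat.
  by rewrite (_ : INR 1 = 1) // => *; apply: Rabs_le; lra.
rewrite mulSn -addnA iotaD count_cat count_window // add1n S_INR INRD.
apply: Rle_trans (IHc (s + d)%N); apply: Req_le; f_equal; field; lra.
Qed.

(** The range 2 <= k <= q + 1 is the one where x = q + 2 - k and y = k - 1 are both positive. *)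
Definition progression q := [seq (1 + q * k)%N | k <- iota 2 q].

Lemma progression_count q d : (0 < d)%N -> coprime d q ->
  Rabs (\rsum_(a <- progression q | d %| a) 1 - INR q / INR d) <= 1.
Proof.
move=> d0 dq; have := count_progression 2 q d0 dq.
suff -> : \rsum_(a <- progression q | d %| a) 1 = INR (count (fun k => d %| 1 + q * k) (iota 2 q)) by [].
rewrite big_map -big_filter rsum_cst size_filter; lra.
Qed.

Lemma bigOmega_rsum a m : (0 < a <= m)%N ->
  INR (bigOmega a) = \rsum_(p <- index_iota 0 m.+1) INR (logn p a).
Proof.
case/andP=> a0 am; have INR0 : INR 0 = 0 by [].
rewrite /bigOmega (big_morph INR INRD INR0).
rewrite (@rsum_mem (primes a) (index_iota 0 m.+1)); [|exact: primes_uniq|exact: iota_uniq|].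
  rewrite big_mkcond; apply: eq_bigr => p _; case: ifPn => // np.
  by move: np; rewrite -logn_gt0 -eqn0Ngt => /eqP ->.
move=> p; rewrite mem_primes mem_index_iota => /and3P[_ _ /dvdn_leq H].
by rewrite ltnS (leq_trans (H a0) am).
Qed.

(* A number without prime factors below [z] and with at least four prime factors has nonpositive
   weight, unless a square [p ^ 2] with [z <= p < y] divides it. *)
Lemma rough_weight_le q z y a Y c : 0 < Y -> (z <= y)%N ->
  (forall p, prime p -> (p < y)%N <-> lnn p <= Y) ->
  coprime a q -> (0 < a)%N -> (4 <= bigOmega a)%N -> c <= 4 - lnn a / Y ->
  ind (rough q z a) * (c - \rsum_(p <- sprimes q z y) ((1 - lnn p / Y) * ind (p %| a))) <=
  4 * \rsum_(p <- sprimes q z y) ind (p ^ 2 %| a).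
Proof.
move=> Y0 zy yP aq a0 om cY; pose W p := 1 - lnn p / Y.
rewrite -[\rsum_(p <- sprimes q z y) (_ * ind (p %| a))]/(\rsum_(p <- sprimes q z y) (W p * ind (p %| a))).
have iY : 0 < / Y by apply: Rinv_0_lt_compat.
have W0 p : prime p -> (p < y)%N -> 0 <= W p.
  move=> pr /(yP p pr) H; rewrite /W; suff : lnn p / Y <= 1 by lra.
  by rewrite -(Rinv_r Y); [apply: Rmult_le_compat_r|]; lra.
have sq0 : 0 <= \rsum_(p <- sprimes q z y) ind (p ^ 2 %| a) by apply: rsum_ge0 => *; exact: ind_ge0.
have c4 : c <= 4.
  by have : 0 <= lnn a / Y; [apply: Rmult_le_pos (lnn_ge0 a) _; lra|lra].
case ra: (rough q z a); last by rewrite [ind false]/=; lra.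
rewrite [ind true]/= Rmult_1_l.
have S0 : 0 <= \rsum_(p <- sprimes q z y) (W p * ind (p %| a)).
  rewrite big_seq; apply: rsum_ge0 => p; rewrite mem_sprimes => /and3P[pr _ /andP[_ py]].
  exact: Rmult_le_pos (W0 _ pr py) (ind_ge0 _).
(* If a square divides a, the right side is at least 4 >= c. *)
have [/hasP[p ps pa]|nsq] := boolP (has (fun p => p ^ 2 %| a) (sprimes q z y)).
  have : ind (p ^ 2 %| a) <= \rsum_(p <- sprimes q z y) ind (p ^ 2 %| a).
    exact: (@rsum_ge_term _ _ (fun p => ind (p ^ 2 %| a)) p (fun i => ind_ge0 _) ps).
  by rewrite {1}pa [ind true]/=; lra.
suff : c <= \rsum_(p <- sprimes q z y) (W p * ind (p %| a)) by lra.
(* Summing 1 - ln p / Y over all prime factors with multiplicity gives Omega(a) - ln a / Y. Factors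
   below y occur once and lie above z, and those from y on contribute at most 0. The bound m = a + y
   covers both the prime factors of a and the primes below y. *)
apply: Rle_trans cY _; pose m := (a + y)%N.
have am : (0 < a <= m)%N by rewrite a0 leq_addr.
apply: Rle_trans (_ : _ <= \rsum_(p <- index_iota 0 m.+1) (INR (logn p a) * W p)) _.
  have -> : \rsum_(p <- index_iota 0 m.+1) (INR (logn p a) * W p) = INR (bigOmega a) - lnn a / Y.
    rewrite (bigOmega_rsum am) (lnn_logn am) /Rdiv -rsum_mulr -rsumB.
    by apply: eq_bigr => p _; rewrite /W; lra.
  by have := ler_INR om; rewrite (_ : INR 4 = 4) /=; lra.
rewrite (@rsum_mem (sprimes q z y) (index_iota 0 m.+1)); first last.
- move=> p; rewrite mem_sprimes mem_index_iota => /and3P[_ _ /andP[_ py]].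
  by rewrite ltnS (leq_trans (ltnW py)) // leq_addl.
- exact: iota_uniq.
- by rewrite filter_uniq ?iota_uniq.
rewrite [X in _ <= X]big_mkcond; apply: ler_rsum => p _.
have [l0|] := posnP (logn p a).
  rewrite l0 Rmult_0_l; case: ifP => [|_]; last lra.
  rewrite mem_sprimes => /and3P[pr _ /andP[_ py]]; exact: Rmult_le_pos (W0 _ pr py) (ind_ge0 _).
rewrite logn_gt0 mem_primes => /and3P[pr _ pa].
have pq : coprime p q by exact: coprime_dvdl pa aq.
have zp : (z <= p)%N.
  rewrite leqNgt; apply/negP => pz; have := allP ra p; rewrite mem_sprimes pr pq pz pa.
  by move/(_ isT).
have [py|yp] := ltnP p y.
  have pm : p \in sprimes q z y by rewrite mem_sprimes pr pq zp py.
  rewrite pm pa [ind true]/= Rmult_1_r.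
  have : (logn p a <= 1)%N.
    by rewrite leqNgt -pfactor_dvdn //; apply: contra nsq => H; apply/hasP; exists p.
  by move/ler_INR; have := W0 _ pr py; rewrite (_ : INR 1 = 1) //; nra.
rewrite mem_sprimes pr pq zp ltnNge yp /=.
have : W p <= 0.
  have : Y < lnn p by apply: Rnot_le_lt => /(yP _ pr); rewrite ltnNge yp.
  move=> H; rewrite /W; suff : 1 <= lnn p / Y by lra.
  by rewrite -(Rinv_r Y); [apply: Rmult_le_compat_r|]; lra.
by have := pos_INR (logn p a); nra.
Qed.

(** Telescoping with 1 / p^2 <= 1 / (p - 1) - 1 / p. *)
Lemma sum_inv_sq u v q : (1 < u)%N -> (u <= v)%N ->
  \rsum_(p <- sprimes q u v) / INR (p ^ 2) <= / (INR u - 1).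
Proof.
move=> u1 uv.
suff H : \rsum_(p <- index_iota u v) / INR (p ^ 2) <= / (INR u - 1) - / (INR v - 1).
  have v2 := INR_ge2 (leq_trans u1 uv).
  have : 0 < / (INR v - 1) by apply: Rinv_0_lt_compat; lra.
  suff : \rsum_(p <- sprimes q u v) / INR (p ^ 2) <= \rsum_(p <- index_iota u v) / INR (p ^ 2) by lra.
  rewrite big_filter; apply: ler_rsum_sub => // p _.
  by rewrite INRX; have [->|p0] := posnP p; [rewrite /= Rmult_0_l Rinv_0; lra|apply/Rlt_le/Rinv_0_lt_compat/pow_lt/INR_gt0].
rewrite -(subnKC uv); elim: (v - u)%N => [|k IHk]; first by rewrite addn0 big_geq //; lra.
rewrite addnS big_nat_recr ?leq_addr // S_INR.
have w2 : 2 <= INR (u + k) by apply: INR_ge2; rewrite ltn_addr.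
apply: Rle_trans (Rplus_le_compat_r _ _ _ IHk) _.
suff : / INR ((u + k) ^ 2) <= / (INR (u + k) - 1) - / (INR (u + k)).
  by rewrite (_ : INR (u + k) + 1 - 1 = INR (u + k)); lra.
rewrite INRX /= Rmult_1_r.
rewrite (_ : / (INR (u + k) - 1) - / INR (u + k) = / (INR (u + k) * (INR (u + k) - 1))); last by field; lra.
apply: Rinv_le_contravar; nra.
Qed.

Definition cost_term (r : seq (option Z * Z)) (i : nat) : Z :=
  ((zinv i - 1000000 / 114) * (1000000 + odflt 0 (nth (None, 1000000) r (130 - i)).1))%Z.

Lemma row_cost_rsum r : IZR (row_cost r) = \rsum_(i <- index_iota 16 114) IZR (cost_term r i).
Proof.
rewrite /row_cost -[fun i c => _]/(fun i c => (cost_term r i + c)%Z).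
elim: (index_iota 16 114) => [|i s IHs]; first by rewrite big_nil.
by rewrite big_cons -IHs -plus_IZR.
Qed.

Lemma Rabs_le_bounds x r : Rabs x <= r -> - r <= x <= r.
Proof. by move=> H; have := Rle_abs x; have := Rle_abs (- x); rewrite Rabs_Ropp; lra. Qed.

Lemma exp_le x y : x <= y -> exp x <= exp y.
Proof. by case=> [/exp_increasing|->]; lra. Qed.

(** * The total weight when q = exp (132 h) *)

Section LargeModulus.
Variables (q : nat) (h : R).
Hypothesis h_large : 2000000 <= h.
Hypothesis q_exp : INR q = exp (132 * h).

Local Notation A := (progression q).
Local Notation z := (cl (16 * h)).
Local Notation V := (eulerV q z).
Local Notation K := (Kout 5).

Let W p := 1 - lnn p / (114 * h).

Let q_gt0 : (0 < q)%N.
Proof. by case: q q_exp => // q0; have := exp_pos (132 * h); rewrite -q0 /=; lra. Qed.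

Let sieve_at D : (forall d, (sieve_error 5 D).1 = Some d ->
    (0 <= d)%Z /\ sieve A q 0 z (K * exp (INR D * h)) (micro d)) /\
  sieve A q 1 z (K * exp (INR D * h)) (micro (sieve_error 5 D).2).
Proof.
have [] := outer_sieve (@progression_count q) h_large 5 D.
rewrite (_ : 2 ^ 5 * (h / 2) = 16 * h); last by rewrite /=; field.
by move=> HU HL _; split=> //; have [] := HL _ (erefl _).
Qed.

Let W01 p : prime p -> (p < cl (114 * h))%N -> 0 <= W p <= 1.
Proof.
move=> pr /(prime_lt_cl _ pr) H; have ih : 0 < / (114 * h) by apply: Rinv_0_lt_compat; lra.
have l0 := lnn_ge0 p; rewrite /W; split.
  suff : lnn p / (114 * h) <= 1 by lra.
  by rewrite -(Rinv_r (114 * h)); [apply: Rmult_le_compat_r|]; lra.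
suff : 0 <= lnn p / (114 * h) by lra.
by apply: Rmult_le_pos; lra.
Qed.

(** The upper sieve is averaged over the multiples of p, which is admissible since p >= z is not a
    sieving prime. *)
Lemma rough_multiples_le D d p : (sieve_error 5 D).1 = Some d ->
  prime p -> coprime p q -> (z <= p)%N ->
  \rsum_(a <- A | p %| a) ind (rough q z a) <=
  INR q / INR p * (V * (1 + micro d)) + K * exp (INR D * h).
Proof.
move=> Ed pr pq zp; have [/(_ _ Ed)[d0 [f [M [Hf HM HV]]]] _] := sieve_at D.
apply: Rle_trans (_ : _ <= \rsum_(a <- A | p %| a) f a) _.
  by apply: ler_rsum => a _; have := Hf a; rewrite /=; lra.
have coz r : r \in sprimes q 0 z -> ~~ (r %| p).
  rewrite mem_sprimes => /and3P[prr _ /andP[_ rz]]; rewrite dvdn_prime2 //.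
  by rewrite neq_ltn (leq_trans rz zp).
have [_ H] := Rabs_le_bounds (HM p (prime_gt0 pr) pq coz).
have p0 := INR_gt0 (prime_gt0 pr).
have qp : 0 <= INR q / INR p.
  by apply: Rmult_le_pos (pos_INR _) _; apply/Rlt_le/Rinv_0_lt_compat.
have : INR q / INR p * M <= INR q / INR p * (V * (1 + micro d)).
  by apply: Rmult_le_compat_l => //; move: HV; rewrite /=; lra.
lra.
Qed.

(** As ln p >= i h, the weight is at most ln p (1 / (i h) - 1 / (114 h)). The sum of ln p / p over
    the block is at most h + 8, which yields the factor 1 + 8 / h. *)
Lemma weighted_block i d : (16 <= i < 114)%N -> (sieve_error 5 (130 - i)).1 = Some d ->
  \rsum_(p <- sprimes q (cl (INR i * h)) (cl (INR i.+1 * h)))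
     (W p * \rsum_(a <- A | p %| a) ind (rough q z a)) <=
  INR q * V * (1 + 8 / h) * ((/ INR i - / 114) * (1 + micro d)) + K * exp (131 * h).
Proof.
case/andP=> i16 i114 Ed; have [/(_ _ Ed)[d0z _] _] := sieve_at (130 - i).
have d0 := micro_ge0 d0z; have [V0 _] := eulerV01 q z; have q0 := INR_gt0 q_gt0.
have K1 := Kout_ge1 5.
have i0 : 16 <= INR i by have := ler_INR i16; rewrite (_ : INR 16 = 16) /=; lra.
have i1 : INR i + 1 <= 114 by have := ler_INR i114; rewrite S_INR (_ : INR 114 = 114) /=; lra.
pose C := INR q * V * (1 + micro d); pose E := K * exp (INR (130 - i) * h).
have C0 : 0 <= C by repeat apply: Rmult_le_pos; lra.
have E0 : 0 <= E by apply: Rmult_le_pos; [lra|apply/Rlt_le/exp_pos].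
have ih0 : 0 < / (INR i * h) by apply: Rinv_0_lt_compat; nra.
have Yh : / (114 * h) <= / (INR i * h) by apply: Rinv_le_contravar; nra.
apply: Rle_trans (_ : _ <= \rsum_(p <- sprimes q (cl (INR i * h)) (cl (INR i.+1 * h)))
    (lnn p / INR p * (C * (/ (INR i * h) - / (114 * h))) + E)) _.
  rewrite big_seq [X in _ <= X]big_seq; apply: ler_rsum => p.
  rewrite mem_sprimes => /and3P[pr pq /andP[ip pi]].
  have zp : (z <= p)%N by apply: leq_trans (cl_le _) ip; nra.
  have [w0 w1] : 0 <= W p <= 1.
    by apply: W01 => //; apply: leq_trans pi (cl_le _); rewrite S_INR; nra.
  have := rough_multiples_le Ed pr pq zp; rewrite -/E => H.
  have p0 := INR_gt0 (prime_gt0 pr); have ip0 := Rinv_0_lt_compat _ p0.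
  have lp : INR i * h <= lnn p.
    by apply: Rnot_lt_le => /Rlt_le/(prime_lt_cl _ pr); rewrite ltnNge ip.
  have Wl : W p <= lnn p * (/ (INR i * h) - / (114 * h)).
    rewrite /W /Rdiv Rmult_minus_distr_l; suff : 1 <= lnn p * / (INR i * h) by lra.
    by rewrite -(Rinv_r (INR i * h)); [apply: Rmult_le_compat_r; lra|nra].
  apply: Rle_trans (Rmult_le_compat_l _ _ _ w0 H) _.
  rewrite Rmult_plus_distr_l; apply: Rplus_le_compat; last by rewrite -[X in _ <= X]Rmult_1_l; apply: Rmult_le_compat_r.
  rewrite (_ : W p * _ = W p * (/ INR p * C)); last by rewrite /C /Rdiv; lra.
  rewrite (_ : lnn p / INR p * _ = lnn p * (/ (INR i * h) - / (114 * h)) * (/ INR p * C)); last by rewrite /Rdiv; lra.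
  by apply: Rmult_le_compat_r Wl; apply: Rmult_le_pos; lra.
rewrite big_split /= rsum_mulr rsum_cst; apply: Rplus_le_compat.
  have : \rsum_(p <- sprimes q (cl (INR i * h)) (cl (INR i.+1 * h))) (lnn p / INR p) <= h + 8.
    have := @mertens_block (INR i * h) (INR i.+1 * h) ltac:(nra) ltac:(rewrite S_INR; nra).
    rewrite (_ : INR i.+1 * h - INR i * h = h); last by rewrite S_INR; lra.
    apply: Rle_trans; rewrite big_filter; apply: ler_rsum_sub => p; first by case/andP.
    by move=> pr; apply: Rmult_le_pos (lnn_ge0 p) _; apply/Rlt_le/Rinv_0_lt_compat/INR_gt0/prime_gt0.
  move=> H; apply: Rle_trans (Rmult_le_compat_r _ _ _ _ H) _.
    by apply: Rmult_le_pos C0 _; lra.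
  by apply: Req_le; rewrite /C; field; lra.
have c1 : (1 < cl (INR i.+1 * h))%N by apply: cl_ge2; rewrite S_INR; nra.
have := ler_INR (size_sprimes q (cl (INR i * h)) c1); rewrite INRD (_ : INR 2 = 2) //.
have [_ cB] := cl_spec (INR i.+1 * h) => sB.
have {sB} sB : INR (size (sprimes q (cl (INR i * h)) (cl (INR i.+1 * h)))) <= exp (INR i.+1 * h) by lra.
apply: Rle_trans (Rmult_le_compat_r _ _ _ E0 sB) _; apply: Req_le.
rewrite /E (_ : exp _ * _ = K * (exp (INR i.+1 * h) * exp (INR (130 - i) * h))); last lra.
rewrite -exp_plus; do 2!f_equal; rewrite -Rmult_plus_distr_r -INRD; f_equal.
rewrite (_ : (i.+1 + (130 - i) = 131)%N); last by rewrite addSn subnKC // (leq_trans (ltnW i114)).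
by rewrite INR_IZR_INZ.
Qed.

Lemma weighted_sum :
  \rsum_(p <- sprimes q z (cl (114 * h))) (W p * \rsum_(a <- A | p %| a) ind (rough q z a)) <=
  INR q * V * (1 + 8 / h) * 1.45 + 98 * K * exp (131 * h).
Proof.
have /and3P[/Z.leb_le/IZR_le cost_le _ /allP someU] := error_row_check.
pose T i := cost_term (error_row 5) i.
have [V0 _] := eulerV01 q z; have q0 := INR_gt0 q_gt0.
have h8 : 0 < 8 / h by apply: Rmult_lt_0_compat; [lra|apply: Rinv_0_lt_compat; lra].
have C0 : 0 <= INR q * V * (1 + 8 / h) by repeat apply: Rmult_le_pos; lra.
suff H n : (n <= 98)%N ->
    \rsum_(p <- sprimes q z (cl (INR (16 + n) * h))) (W p * \rsum_(a <- A | p %| a) ind (rough q z a)) <=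
    INR q * V * (1 + 8 / h) * ((\rsum_(i <- index_iota 16 (16 + n)) IZR (T i)) / 1000000000000)
    + INR n * (K * exp (131 * h)).
  have := H 98%N isT; rewrite (_ : INR (16 + 98) = 114); last by rewrite INR_IZR_INZ.
  rewrite (_ : INR 98 = 98); last by rewrite INR_IZR_INZ.
  rewrite -row_cost_rsum => H1.
  have c145 : IZR (row_cost (error_row 5)) / 1000000000000 <= 1.45 by lra.
  by have := Rmult_le_compat_l _ _ _ C0 c145; lra.
have i16 : INR 16 = 16 by rewrite INR_IZR_INZ.
elim: n => [_|n IHn n98].
  rewrite addn0 i16 /sprimes /index_iota !subnn !big_nil /=; lra.
have {}IHn := IHn (ltnW n98); set i := (16 + n)%N in IHn *.
have si : 16 <= INR i by rewrite /i INRD i16; have := pos_INR n; lra.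
have mi : (16 <= i < 114)%N by rewrite leq_addr /= -[114%N]/(16 + 98)%N ltn_add2l.
have [d Ed] : exists d, (sieve_error 5 (130 - i)).1 = Some d.
  have := someU i; rewrite mem_index_iota mi => /(_ isT).
  by rewrite -/(sieve_error 5 (130 - i)); case: (sieve_error _ _).1 => // d _; exists d.
rewrite addnS -/i; clearbody i; rewrite (@sprimes_cat _ _ (cl (INR i * h))); first last.
- by apply: cl_le; rewrite S_INR; nra.
- by apply: cl_le; nra.
rewrite big_cat; apply: Rle_trans (Rplus_le_compat _ _ _ _ IHn (weighted_block mi Ed)) _.
have [i16' _] := andP mi; rewrite (big_nat_recr _ _ _ i16').
rewrite S_INR; have [/(_ _ Ed)[d0 _] _] := sieve_at (130 - i).
have H1 : (/ INR i - / 114) * (1 + micro d) <= IZR (T i) / 1000000000000.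
  have -> : IZR (T i) / 1000000000000 = IZR (zinv i - 1000000 / 114) / 1000000 * (1 + micro d).
    rewrite /T /cost_term -/(sieve_error 5 (130 - i)) Ed [odflt _ _]/= mult_IZR plus_IZR /micro; lra.
  apply: Rmult_le_compat_r; first by have := micro_ge0 d0; lra.
  rewrite minus_IZR (_ : (1000000 / 114 = 8771)%Z) //.
  by have := @zinv_ge i (leq_trans (isT : (0 < 16)%N) i16'); lra.
have := Rmult_le_compat_l _ _ _ C0 H1.
move=> H2; set S := \rsum_(_ <- _) _; set X := INR q * V * (1 + 8 / h) in H2 *.
rewrite [X in _ <= X](_ : _ = X * ((S + IZR (T i)) / 1000000000000) + (INR n + 1) * (K * exp (131 * h))) //.
lra.
Qed.

Lemma rough_count_ge :
  INR q * V * 0.982 - K * exp (131 * h) <= \rsum_(a <- A) ind (rough q z a).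
Proof.
have /and3P[_ /Z.leb_le/IZR_le le18 _] := error_row_check.
have [_ [f [M [Hf HM HV]]]] := sieve_at 131.
rewrite -/(sieve_error 5 131) in le18.
have [V0 _] := eulerV01 q z; have q0 := INR_gt0 q_gt0.
have H131 : INR 131 = 131 by rewrite INR_IZR_INZ.
have co1 r : r \in sprimes q 0 z -> ~~ (r %| 1).
  by rewrite mem_sprimes dvdn1 => /andP[/prime_gt1]; case: r => [|[]].
have [H _] := Rabs_le_bounds (HM 1%N isT (coprime1n q) co1).
have fr : \rsum_(a <- A | 1 %| a) f a <= \rsum_(a <- A) ind (rough q z a).
  by under eq_bigl => a do rewrite dvd1n; apply: ler_rsum => a _; have := Hf a; rewrite /=; lra.
have : 0.982 * V <= M.
  have d18 : micro (sieve_error 5 131).2 <= 0.018 by rewrite /micro; lra.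
  by move: HV; rewrite [(-1) ^ 1]/=; move: (micro _) d18 => d d18; nra.
move/(Rmult_le_compat_l _ _ _ (Rlt_le _ _ q0)); move: H; rewrite H131 /Rdiv Rinv_1; lra.
Qed.

(** [rough_weight_le] summed over the progression, after interchanging the sums over a and p. *)
Let rough_sum_le c : c <= 4 - (264 * h + 1) / (114 * h) ->
  (forall a, a \in A -> (4 <= bigOmega a)%N) ->
  c * (\rsum_(a <- A) ind (rough q z a)) -
    \rsum_(p <- sprimes q z (cl (114 * h))) (W p * \rsum_(a <- A | p %| a) ind (rough q z a)) <=
  4 * \rsum_(p <- sprimes q z (cl (114 * h))) \rsum_(a <- A | p ^ 2 %| a) 1.
Proof.
move=> c_le om; set s := sprimes _ _ _.
have q2 : (1 < q)%N.
  apply/ltP/INR_lt; rewrite q_exp; have := exp_ineq1_le (132 * h); rewrite /=; lra.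
have -> : \rsum_(p <- s) (W p * \rsum_(a <- A | p %| a) ind (rough q z a)) =
    \rsum_(a <- A) \rsum_(p <- s) (W p * ind (p %| a) * ind (rough q z a)).
  rewrite exchange_big; apply: eq_bigr => p _; rewrite big_mkcond Rmult_comm -rsum_mulr.
  by apply: eq_bigr => a _; case: (p %| a) => /=; lra.
have -> : \rsum_(p <- s) \rsum_(a <- A | p ^ 2 %| a) 1 =
    \rsum_(a <- A) \rsum_(p <- s) ind (p ^ 2 %| a).
  by rewrite exchange_big; apply: eq_bigr => p _; rewrite big_mkcond; apply: eq_bigr.
rewrite Rmult_comm -rsum_mulr -rsumB [X in _ <= X]Rmult_comm -rsum_mulr big_seq [X in _ <= X]big_seq.
apply: ler_rsum => a aA; rewrite rsum_mulr.
have := om a aA; case/mapP: aA => k; rewrite mem_iota => /andP[_ k_le] -> omk.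
have cop : coprime (1 + q * k) q by rewrite coprime_sym /coprime addnC mulnC gcdnMDl gcdn1.
have zy : (z <= cl (114 * h))%N by apply: cl_le; lra.
(* a <= 1 + q (q + 1) <= 2 q^2, and ln q = 132 h. *)
have ln_a : lnn (1 + q * k) <= 264 * h + 1.
  apply: Rle_trans (_ : _ <= lnn (2 * (q * q))) _.
    apply: ler_lnn => //; move: k_le q2 => kq q2.
    have kq' : (k <= q.+1)%N by move: kq; rewrite add2n ltnS.
    apply: leq_trans (_ : 1 + q * q.+1 <= _)%N; first by rewrite leq_add2l leq_mul2l kq' orbT.
    rewrite mulnS mul2n -addnn addnA leq_add2r add1n.
    by apply: leq_trans (_ : q * 2 <= _)%N; rewrite ?leq_mul2l ?q2 ?orbT // muln2 -addnn -add1n leq_add2r.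
  rewrite !lnnM ?muln_gt0 ?q_gt0 // /lnn q_exp ln_exp (_ : INR 2 = 2) //.
  by have := ln2_lt1; lra.
have cY : c <= 4 - lnn (1 + q * k) / (114 * h).
  apply: Rle_trans c_le _; suff : lnn (1 + q * k) / (114 * h) <= (264 * h + 1) / (114 * h) by lra.
  by apply: Rmult_le_compat_r ln_a; apply/Rlt_le/Rinv_0_lt_compat; lra.
have Y0 : 0 < 114 * h by lra.
have := rough_weight_le Y0 zy (fun p => prime_lt_cl (114 * h) (p := p)) cop isT omk cY.
by rewrite -/s /W; lra.
Qed.

(** At most q / p^2 + 1 terms are divisible by p^2: the first part sums to about q / z = exp (116
    h), the second to at most the number of p. *)
Let sum_sq_le : \rsum_(p <- sprimes q z (cl (114 * h))) \rsum_(a <- A | p ^ 2 %| a) 1 <=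
  2 * exp (116 * h) + exp (114 * h).
Proof.
have zy : (z <= cl (114 * h))%N by apply: cl_le; lra.
have z2 : (1 < z)%N by apply: cl_ge2; lra.
have q0 := INR_gt0 q_gt0.
apply: Rle_trans (_ : _ <= \rsum_(p <- sprimes q z (cl (114 * h))) (/ INR (p ^ 2) * INR q + 1)) _.
  rewrite big_seq [X in _ <= X]big_seq; apply: ler_rsum => p; rewrite mem_sprimes => /and3P[pr pq _].
  have p2 : (0 < p ^ 2)%N by rewrite expn_gt0 prime_gt0.
  have := progression_count p2 (coprimeXl 2 pq) => /Rabs_le_bounds; rewrite /Rdiv; lra.
rewrite big_split /= rsum_mulr rsum_cst Rmult_1_r; apply: Rplus_le_compat.
  have e16 := exp_ineq1_le (16 * h); have [cz _] := cl_spec (16 * h).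
  have iz : / (INR z - 1) <= 2 * exp (- (16 * h)).
    rewrite exp_Ropp (_ : 2 * _ = / (exp (16 * h) / 2)); last by field; lra.
    by apply: Rinv_le_contravar; lra.
  apply: Rle_trans (Rmult_le_compat_r _ _ _ (Rlt_le _ _ q0) (Rle_trans _ _ _ (sum_inv_sq q z2 zy) iz)) _.
  rewrite q_exp Rmult_assoc -exp_plus; apply: Req_le; do 2!f_equal; lra.
have y2 := leq_trans z2 zy; have := ler_INR (size_sprimes q z y2).
by rewrite INRD (_ : INR 2 = 2) //; have [_] := cl_spec (114 * h); lra.
Qed.

Lemma exists_P3 : 8000000 * K * Kin < h -> exists2 a, a \in A & (bigOmega a <= 3)%N.
Proof.
move=> hK; have [/hasP//|no] := boolP (has (fun a => (bigOmega a <= 3)%N) A).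
have om a : a \in A -> (4 <= bigOmega a)%N.
  by move=> aA; rewrite ltnNge; apply: contra no => H; apply/hasP; exists a.
exfalso; have K1 := Kout_ge1 5; have Kin1 := Kin_ge1; have [V0 _] := eulerV01 q z.
have ih : / h <= / 2000000 by apply: Rinv_le_contravar; lra.
have ih0 : 0 < / h by apply: Rinv_0_lt_compat; lra.
have c_le : 1.684 <= 4 - (264 * h + 1) / (114 * h).
  rewrite (_ : (264 * h + 1) / (114 * h) = 264 / 114 + / h / 114); last by field; lra.
  by lra.
have q0 := INR_gt0 q_gt0; have qV : 0 <= INR q * V by apply: Rmult_le_pos; lra.
have e131 := exp_pos (131 * h).
have e116 : exp (116 * h) <= exp (131 * h) by apply: exp_le; lra.
have e114 : exp (114 * h) <= exp (131 * h) by apply: exp_le; lra.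
have KE : exp (131 * h) <= K * exp (131 * h) by nra.
(* 1.684 * 0.982 - 1.45 (1 + 8 / h) exceeds 0.1, and the error terms add up to 98 + 1.684 + 4 (2 +
   1) <= 114. *)
have main : 0.1 * (INR q * V) <= 114 * (K * exp (131 * h)).
  have := rough_sum_le c_le om; have := sum_sq_le; have := rough_count_ge; have := weighted_sum.
  have : INR q * V * (8 / h) <= INR q * V * 0.00001 by apply: Rmult_le_compat_l; lra.
  lra.
have [m hm] : exists m, 16 * h < 2 ^ m * 2000000.
  have [m Hm] := Pow_x_infinity 2 ltac:(rewrite Rabs_pos_eq; lra) (16 * h).
  exists m; have := Hm m (le_n m); rewrite Rabs_pos_eq; last by apply: pow_le; lra.
  by have := pow_R1_Rle 2 m; lra.
have h16 : 1000000 <= 16 * h by lra.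
have [_ _ V_ge] := inner_sieve (@progression_count q) h16 hm (isT : ~~ odd 4) (isT : (4 <= 4)%N).
have qE : INR q = exp h * exp (131 * h) by rewrite q_exp -exp_plus; f_equal; lra.
(* Cubic growth suffices: q V exceeds exp (131 h) by at least exp h / (Kin (16 h)^2), and exp h >=
   (h / 3)^3. *)
have h3 : h ^ 3 / 27 <= exp h.
  rewrite (_ : exp h = exp (h / 3) ^ 3); last by rewrite expX (_ : INR 3 = 3) /=; [f_equal; field|lra].
  rewrite (_ : h ^ 3 / 27 = (h / 3) ^ 3); last by field.
  by apply: pow_incr; have := exp_ineq1_le (h / 3); lra.
have D0 : 0 < Kin * (16 * h) ^ 2 by apply: Rmult_lt_0_compat; [lra|apply: pow_lt; lra].
have H1 : 0.1 * exp h * V <= 114 * K.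
  apply: (Rmult_le_reg_r (exp (131 * h))) => //; move: main; rewrite qE; lra.
have H2 : 1 <= V * (Kin * (16 * h) ^ 2).
  by rewrite -(Rinv_l (Kin * (16 * h) ^ 2)); [apply: Rmult_le_compat_r; lra|lra].
have e0 := exp_pos h.
have H3 : 0.1 * exp h <= 114 * K * (Kin * (16 * h) ^ 2).
  apply: Rle_trans (Rmult_le_compat_r _ _ _ (Rlt_le _ _ D0) H1).
  by have := Rmult_le_compat_l _ _ _ (Rlt_le _ _ e0) H2; lra.
(* 7879680 = 27 * 10 * 114 * 16^2. *)
have H4 : h * h ^ 2 <= (7879680 * K * Kin) * h ^ 2.
  by move: H3 h3; rewrite /=; lra.
have h20 : 0 < h ^ 2 by apply: pow_lt; lra.
have := Rmult_le_reg_r _ _ _ h20 H4.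
have : 1 <= K * Kin by nra.
lra.
Qed.

End LargeModulus.

(* Return to the representations of n *)
Local Close Scope R_scope.

Theorem theorem1 :
  exists N0 : nat, forall n : nat, N0 <= n ->
    (exists x y : nat, [/\ 0 < x, 0 < y, n = x + y & bigOmega (x + n * y) <= 3])
    \/
    (exists x y : nat, [/\ 0 < x, 0 < y, n = x + y &
                          bigOmega (x ^ 2 + n * y ^ 2) <= 4]).
Proof.
(* H0 exceeds both lower bounds that [exists_P3] requires of h. *)
pose H0 : R := (8000000 * Kout 5 * Kin + 2000000)%R.
exists (cl (132 * H0)).+1 => -[//|q]; rewrite ltnS => cl_q; left.
have K1 := Kout_ge1 5; have Kin1 := Kin_ge1.
have KK : (1 <= Kout 5 * Kin)%R by nra.
have [c1 _] := cl_spec (132 * H0)%R; have e0 := exp_pos (132 * H0)%R.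
have q_ge : (exp (132 * H0) <= INR q)%R by have := ler_INR cl_q; lra.
(* h is real, so q = exp (132 h) holds exactly. *)
pose h : R := (lnn q / 132)%R.
have h_ge : (H0 <= h)%R.
  have := ler_ln e0 q_ge; rewrite ln_exp /h -/(lnn q); lra.
have q_exp : INR q = exp (132 * h)%R.
  by rewrite /h (_ : (132 * (lnn q / 132) = lnn q)%R); [rewrite exp_ln; lra|field].
have [||a /mapP[k]] := @exists_P3 q h _ q_exp; rewrite /H0 in h_ge; try lra.
rewrite mem_iota => /andP[k2 kq] -> om.
(* With n = q + 1 this choice gives x + n y = 1 + q k. *)
exists (q + 2 - k), (k - 1); split; [lia|lia|lia|].
have -> : q + 2 - k + q.+1 * (k - 1) = 1 + q * k by nia.
exact: om.
Qed.
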